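(* Let $0<\eta<1$. Assume that $A(x)\sim\log\log x$ as $x\to\infty$ and that $B=\sum_{k\ge1}a_k^4<\infty$. Then there exists an absolute constant $C>0$ such that for all $x$ large enough, $$\mathbb P\Big\{\sup_{0\le t\le1}X_x(t)\le\sqrt{2\eta(\log\log x)(\log\log\log x)}\Big\}\le \exp\Bigg\{-\frac{C(\log\log x)^{1-\eta}}{\sqrt{8\eta(B+1)(\log\log\log x)}}\Bigg\}.$$
   Context: $(a_k)_{k\ge1}$ is a sequence of real numbers, $A(x)=\sum_{k\le x}a_k^2$, $(j_k)_{k\ge 1}$ is an increasing sequence of positive integers, and $(g_k)_{k\ge1}$, $(g'_k)_{k\ge1}$ are two independent sequences of i.i.d. $\mathcal N(0,1)$ random variables on a common probability space. For real $x\ge1$, $$X_x(t)=\sum_{1\le k\le x}a_k\big(g_k\cos 2\pi j_kt+g'_k\sin2\pi j_kt\big),\quad 0\le t\le1.$$ *)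

(* Defs.v *)
From HB Require Import structures.
From mathcomp Require Import all_boot all_order all_algebra.
From mathcomp Require Import all_classical all_reals all_analysis.

Set Implicit Arguments.
Unset Strict Implicit.
Unset Printing Implicit Defensive.

Import Order.TTheory GRing.Theory Num.Theory.
Import numFieldNormedType.Exports.

Local Open Scope classical_set_scope.
Local Open Scope ring_scope.

(** Sequences [(u_k)_{k >= 1}] are functions on [nat] whose value at [0] is
    never used; for [x >= 0], the integers [1 <= k <= x] are those with
    [1 <= k < (Num.truncn x).+1]. *)

Definition loglog {R : realType} (x : R) : R := ln (ln x).

Definition logloglog {R : realType} (x : R) : R := ln (ln (ln x)).

Definition sum_squares {R : realType} (a : nat -> R) (x : R) : R :=
  \sum_(1 <= k < (Num.truncn x).+1) a k ^+ 2.

Definition random_trig_poly {R : realType} {T : Type} (a : nat -> R)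
    (j : nat -> nat) (g g' : nat -> T -> R) (x t : R) (w : T) : R :=
  \sum_(1 <= k < (Num.truncn x).+1)
    a k * (g k w * cos (2 * pi * (j k)%:R * t)
           + g' k w * sin (2 * pi * (j k)%:R * t)).

Definition mutually_independent {R : realType} {d : measure_display}
    {T : measurableType d} (P : probability T R) (D : set nat)
    (X : nat -> {RV P >-> R}) : Prop :=
  forall (J : seq nat) (E : nat -> set R),
    uniq J -> [set` J] `<=` D -> (forall k, measurable (E k)) ->
    P (\bigcap_(k in [set` J]) (X k @^-1` E k)) =
      (\prod_(k <- J) P (X k @^-1` E k))%E.

Definition sigma_of_family {R : realType} {d : measure_display}
    {T : measurableType d} (P : probability T R) (D : set nat)
    (X : nat -> {RV P >-> R}) : set (set T) :=
  <<s \bigcup_(k in D) preimage_set_system setT (X k) measurable >>.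

Definition independent_families {R : realType} {d : measure_display}
    {T : measurableType d} (P : probability T R) (D : set nat)
    (X Y : nat -> {RV P >-> R}) : Prop :=
  forall E F : set T, sigma_of_family D X E -> sigma_of_family D Y F ->
    P (E `&` F) = (P E * P F)%E.

Definition iid_standard_normal {R : realType} {d : measure_display}
    {T : measurableType d} (P : probability T R) (D : set nat)
    (X : nat -> {RV P >-> R}) : Prop :=
  mutually_independent D X /\
  forall k, D k -> forall E : set R, measurable E ->
    distribution P (X k) E = normal_prob 0 1 E.

(* Main.v *)
Require Import Defs.
From HB Require Import structures.
From mathcomp Require Import all_boot all_order all_algebra.
From mathcomp Require Import all_classical all_reals all_analysis.
From mathcomp Require Import measurable_realfun ring lra zify.
Import Order.TTheory GRing.Theory Num.Theory.
Import numFieldNormedType.Exports.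
Local Open Scope classical_set_scope.
Local Open Scope ring_scope.

Set Implicit Arguments.
Unset Strict Implicit.
Unset Printing Implicit Defensive.

(** Restrict [t] to a grid of [N > 2 j_n] equally spaced points and put
    [F = avg_i (X(t_i) - z)_+], which vanishes when the supremum is at most
    [z]. Freeze the coefficients with [a_k^2 > tau]; they contribute a function
    of mean zero on the grid, and since [sum a_k^4 = B] their total variance is
    at most [B / tau]. Rotate the remaining Gaussian vector in [m] small steps
    into an independent copy (Maurey-Pisier): the convexity of [F] bounds each
    increment by a linear form in the copy, whose squared norm is at most
    [tau / 2] by Bessel's inequality. Letting [m] grow, this yields
    [P(sup X <= z) <= 2 exp (1 + lam^2 tau - lam mu)] for all [lam >= 0], where
    [mu] bounds from below the mean of [(sigma g - z)_+] with [g] standard normal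
    and [sigma^2] the variance of the rotated part; freezing the large
    coefficients does not decrease the mean of [F], by Jensen's inequality.
    With [L = log log x], [tau = L^(-1 + (1 - eta) / 4)] and
    [lam = mu / (2 tau)], the exponent is at most [1 - c L^(3 (1 - eta) / 2)],
    which beats [L^(1 - eta)]. *)

(** * Standard normal law *)

Section density.
Context d (T : measurableType d) (R : realType).
Variables (mu nu : {measure set T -> \bar R}) (h : T -> R).
Hypotheses (mh : measurable_fun setT h) (h0 : forall x, 0 <= h x).
Hypothesis nuE : forall A, measurable A -> nu A = (\int[mu]_(x in A) (h x)%:E)%E.
Local Open Scope ereal_scope.
Import HBNNSimple.

Let mhE : measurable_fun setT (EFin \o h).
Proof. exact/measurable_EFinP. Qed.

Let h0E x : 0 <= (h x)%:E.
Proof. by rewrite lee_fin. Qed.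

(** Both sides are sums over the levels of [f], and on a single level set the identity is [nuE]. A
    negative level has an empty preimage, so it contributes nothing. *)
Lemma nnsfun_integral_density (f : {nnsfun T >-> R}) :
  \int[nu]_x (f x)%:E = \int[mu]_x ((f x)%:E * (h x)%:E).
Proof.
under [LHS]eq_integral do rewrite fimfunE -fsumEFin//.
rewrite [LHS]ge0_integral_fsum//; last 2 first.
  - by move=> r; exact/measurable_EFinP/measurableT_comp.
  - by move=> n x _; rewrite EFinM nnfun_muleindic_ge0.
under [RHS]eq_integral.
  move=> x xD; rewrite fimfunE -fsumEFin// ge0_mule_fsuml; last first.
    by move=> r; rewrite EFinM nnfun_muleindic_ge0.
  over.
rewrite [RHS]ge0_integral_fsum//; last 2 first.
  - by move=> r; apply: emeasurable_funM => //; apply/measurable_EFinP; exact/measurableT_comp.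
  - by move=> n x _; rewrite mule_ge0// EFinM nnfun_muleindic_ge0.
apply: eq_fsbigr => r _.
rewrite integralZl_indic_nnsfun//= integral_indic// setIT nuE//.
have [r0|r0] := leP 0%R r.
  under [RHS]eq_integral do rewrite EFinM -muleA.
  rewrite ge0_integralZl//; last 2 first.
  - by apply: emeasurable_funM => //; apply/measurable_EFinP; exact/measurable_indic.
  - by move=> x _; rewrite mule_ge0// lee_fin.
  congr (_ * _); rewrite integral_mkcond; apply: eq_integral => x _.
  by rewrite patchE indicE; case: ifPn => _; rewrite ?mul1e ?mul0e.
by rewrite preimage_nnfun0 // integral_set0 mule0 integral0_eq// => x _; rewrite indicE in_set0 mulr0 mul0e.
Qed.

Lemma ge0_integral_density (f : T -> \bar R) :
  measurable_fun setT f -> (forall x, 0 <= f x) ->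
  \int[nu]_x f x = \int[mu]_x (f x * (h x)%:E).
Proof.
move=> mf f0.
pose f_ := nnsfun_approx measurableT mf.
have cf x : (f_ n x)%:E @[n --> \oo] --> f x by apply: cvg_nnsfun_approx.
transitivity (limn (fun n => \int[nu]_x (f_ n x)%:E)).
  rewrite -monotone_convergence//=.
  - by apply: eq_integral => x _; apply/esym/cvg_lim.
  - by move=> n; exact/measurable_EFinP.
  - by move=> n x _; rewrite lee_fin.
  - by move=> x _ m n mn; rewrite lee_fin; exact/lefP/nd_nnsfun_approx.
under eq_fun do rewrite nnsfun_integral_density.
rewrite -monotone_convergence//=.
- apply: eq_integral => x _; apply/cvg_lim => //.
  by apply: cvgeZr.
- by move=> n; apply: emeasurable_funM => //; exact/measurable_EFinP.
- by move=> n x _; rewrite mule_ge0// lee_fin.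
- by move=> x _ m n mn; rewrite lee_wpmul2r// lee_fin; exact/lefP/nd_nnsfun_approx.
Qed.

End density.

(** * Rotation invariance of the Gaussian measure on the plane *)

Section plane_rotation.
Context {R : realType}.
Local Notation leb := (@lebesgue_measure R).
Local Notation gauss := (@normal_prob R 0 1).
Local Open Scope ereal_scope.

(** The image of Lebesgue measure under the translation gives every half-open interval its length,
    so it is Lebesgue measure by uniqueness. *)
Lemma ge0_integral_translate (c : R) (f : R -> \bar R) :
  measurable_fun setT f -> (forall x, 0 <= f x) ->
  \int[leb]_x f (x + c)%R = \int[leb]_x f x.
Proof.
move=> mf f0.
have mc : measurable_fun [set: measurableTypeR R] (fun x : measurableTypeR R => x + c : measurableTypeR R)%R.
  by apply: measurable_funD.
pose phi : {mfun measurableTypeR R >-> measurableTypeR R} := HB.pack (fun x : measurableTypeR R => x + c : measurableTypeR R)%R (isMeasurableFun.Build _ _ _ _ _ mc).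
rewrite -[LHS](ge0_integral_pushforward mc leb measurableT)//.
apply: eq_measure_integral => A mA _; apply/esym.
apply: (lebesgue_measure_unique (mu := pushforward leb phi)) => //= _ [[a b]] _ <-.
rewrite /pushforward.
have -> : (phi @^-1` `]a, b])%classic = `](a - c)%R, (b - c)%R]%classic.
  by apply/seteqP; split => x; rewrite /= !in_itv/= ltrBlDr lerBrDr.
rewrite !lebesgue_measure_itv/= !lte_fin ltrD2r.
by case: ifP => // _; rewrite -!EFinD opprB addrA subrK.
Qed.

Lemma integral_normalE (f : R -> \bar R) :
  measurable_fun setT f -> (forall x, 0 <= f x) ->
  \int[gauss]_x f x = \int[leb]_x (f x * (normal_pdf 0 1 x)%:E).
Proof.
move=> mf f0; apply: ge0_integral_density => //.
- exact: measurable_normal_pdf.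
- by move=> x; rewrite normal_pdf_ge0.
Qed.

(** After Tonelli the inner variable is [x], and for fixed [y] the shear is a translation by
    [b * y]. *)
Lemma ge0_integral_shear1 (b : R) (H : R * R -> \bar R) :
  measurable_fun setT H -> (forall z, 0 <= H z) ->
  \int[leb]_x \int[leb]_y H (x + b * y, y)%R = \int[leb]_x \int[leb]_y H (x, y).
Proof.
move=> mH H0.
have mS : measurable_fun [set: R * R] (fun z : R * R => (z.1 + b * z.2, z.2))%R.
  apply: measurable_fun_pair => //=; apply: measurable_funD => //.
  by apply: measurable_funM.
apply: etrans (fubini_tonelli (m1 := leb) (m2 := leb) _ (measurableT_comp mH mS) (fun z => H0 _)) _.
apply: etrans _ (esym (fubini_tonelli (m1 := leb) (m2 := leb) _ mH H0)).
apply: eq_integral => y _ /=.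
apply: (ge0_integral_translate (b * y) (f := fun x => H (x, y))) => //.
apply: (measurableT_comp mH) => //; exact: pair2_measurable.
Qed.

Lemma ge0_integral_shear2 (b : R) (H : R * R -> \bar R) :
  measurable_fun setT H -> (forall z, 0 <= H z) ->
  \int[leb]_x \int[leb]_y H (x, y + b * x)%R = \int[leb]_x \int[leb]_y H (x, y).
Proof.
move=> mH H0; apply: eq_integral => x _.
apply: (ge0_integral_translate (b * x) (f := fun y => H (x, y))) => //.
apply: (measurableT_comp mH) => //; exact: pair1_measurable.
Qed.

(** The joint density depends on the point only through its Euclidean norm; this is the source of
    the rotation invariance. *)
Lemma normal_pdf01M (x y : R) : (normal_pdf 0 1 x * normal_pdf 0 1 y)%R =
  (normal_peak 1 ^+ 2 * expR (- (x ^+ 2 + y ^+ 2) / 2))%R :> R.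
Proof.
rewrite !normal_pdfE ?oner_eq0// /normal_fun mulrACA -expRD -expr2; congr (_ * expR _)%R.
by rewrite !subr0 expr1n; lra.
Qed.

Let gauss2E (F : R * R -> \bar R) : measurable_fun setT F -> (forall z, 0 <= F z) ->
  \int[gauss]_x \int[gauss]_y F (x, y) = \int[leb]_x \int[leb]_y
    (F (x, y) * (normal_peak 1 ^+ 2 * expR (- (x ^+ 2 + y ^+ 2) / 2))%:E).
Proof.
move=> mF F0.
rewrite integral_normalE//=; last 2 first.
- exact: measurable_fun_fubini_tonelli_F.
- by move=> x; apply: integral_ge0.
apply: eq_integral => x _; rewrite integral_normalE//; last first.
  by apply: (measurableT_comp mF) => //; exact: pair1_measurable.
rewrite muleC -ge0_integralZl//.
- by apply: eq_integral => y _; rewrite muleC -muleA -EFinM mulrC normal_pdf01M.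
- apply: emeasurable_funM.
    by apply: (measurableT_comp mF) => //; exact: pair1_measurable.
  by apply/measurable_EFinP; exact: measurable_normal_pdf.
- by move=> y _; rewrite mule_ge0// lee_fin normal_pdf_ge0.
- by rewrite lee_fin normal_pdf_ge0.
Qed.

(* A rotation of the plane is a product of three shears, each of which preserves the Lebesgue measure. *)
Let rot_neq0 (c s : R) (F : R * R -> \bar R) : s != 0%R -> (c ^+ 2 + s ^+ 2 = 1)%R ->
  measurable_fun setT F -> (forall z, 0 <= F z) ->
  \int[gauss]_x \int[gauss]_y F (c * x + s * y, - s * x + c * y)%R
  = \int[gauss]_x \int[gauss]_y F (x, y).
Proof.
move=> s0 cs mF F0.
have mlin (a b : R) : measurable_fun [set: R * R] (fun z : R * R => a * z.1 + b * z.2)%R.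
  by apply: measurable_funD; apply: measurable_funM.
rewrite (gauss2E (F := fun z : R * R => F (c * z.1 + s * z.2, - s * z.1 + c * z.2)%R))//; last first.
  by apply: (measurableT_comp mF); apply: measurable_fun_pair.
rewrite [RHS](gauss2E mF F0).
pose H z := F z * (normal_peak 1 ^+ 2 * expR (- (z.1 ^+ 2 + z.2 ^+ 2) / 2))%:E.
have H0 z : 0 <= H z by rewrite mule_ge0// lee_fin mulr_ge0 ?expR_ge0 ?sqr_ge0.
have mH : measurable_fun setT H.
  apply: emeasurable_funM => //; apply/measurable_EFinP; apply: measurable_funM => //.
  apply: measurableT_comp => //; apply: measurable_funM => //.
  by apply: measurableT_comp => //; apply: measurable_funD => //; exact: measurable_funX.
(* For [c] and [s] the cosine and sine of an angle, [b] is the tangent of half of it: the rotation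
   is the horizontal shear by [b], then the vertical shear by [- s], then the horizontal shear by
   [b] again. *)
pose b := ((1 - c) / s)%R.
have mS (a : R) : measurable_fun [set: R * R] (fun z : R * R => (z.1 + a * z.2, z.2)%R).
  by apply: measurable_fun_pair => //=; apply: measurable_funD => //; apply: measurable_funM.
have mS' (a : R) : measurable_fun [set: R * R] (fun z : R * R => (z.1, z.2 + a * z.1)%R).
  by apply: measurable_fun_pair => //=; apply: measurable_funD => //; apply: measurable_funM.
pose H1 z := H (z.1 + b * z.2, z.2)%R.
pose H2 z := H1 (z.1, z.2 + - s * z.1)%R.
have mH1 : measurable_fun setT H1 by exact: (measurableT_comp mH (mS b)).
have mH2 : measurable_fun setT H2 by exact: (measurableT_comp mH1 (mS' (- s)%R)).
have E1 := ge0_integral_shear1 b mH H0.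
have E2 := ge0_integral_shear2 (- s) mH1 (fun z => H0 _).
have E3 := ge0_integral_shear1 b mH2 (fun z => H0 _).
apply: etrans (etrans E3 (etrans E2 E1)).
apply: eq_integral => x _; apply: eq_integral => y _; rewrite /H2 /H1 /H/=.
have sb : (s * b = 1 - c)%R by rewrite /b mulrC divfK.
have e2 : (y + - s * (x + b * y) = - s * x + c * y)%R.
  by transitivity (- s * x + (1 - s * b) * y)%R; [ring|rewrite sb; ring].
have e1 : (x + b * y + b * (- s * x + c * y) = c * x + s * y)%R.
  apply: (mulfI s0).
  transitivity (s * x + s * b * y + s * b * (- s * x + c * y))%R; first ring.
  rewrite sb; transitivity (s * c * x + (c ^+ 2 + s ^+ 2 - c ^+ 2) * y)%R; last ring.
  by rewrite cs; ring.
rewrite e2 e1; congr (_ * (_ * expR (- _ / 2))%:E)%E.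
by transitivity ((c ^+ 2 + s ^+ 2) * (x ^+ 2 + y ^+ 2))%R; [rewrite cs mul1r|ring].
Qed.

Lemma ge0_integral_rotation (c s : R) (F : R * R -> \bar R) : (c ^+ 2 + s ^+ 2 = 1)%R ->
  measurable_fun setT F -> (forall z, 0 <= F z) ->
  \int[gauss]_x \int[gauss]_y F (c * x + s * y, - s * x + c * y)%R
  = \int[gauss]_x \int[gauss]_y F (x, y).
Proof.
move=> cs mF F0; have [s0|s0] := eqVneq s 0%R; last exact: rot_neq0.
have /eqP : (c ^+ 2 = 1)%R by rewrite -cs s0 expr0n addr0.
rewrite s0 sqrf_eq1 => /orP[/eqP ->|/eqP ->].
  apply: eq_integral => x _; apply: eq_integral => y _.
  by rewrite oppr0 !mul0r !mul1r addr0 add0r.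
(* the half turn is the square of a quarter turn *)
have q (G : R * R -> \bar R) : measurable_fun setT G -> (forall z, 0 <= G z) ->
  \int[gauss]_x \int[gauss]_y G (0 * x + 1 * y, - 1 * x + 0 * y)%R
  = \int[gauss]_x \int[gauss]_y G (x, y).
  by apply: rot_neq0; rewrite ?oner_eq0// expr0n expr1n/= add0r.
have mF' : measurable_fun setT (fun z : R * R => F (z.2, - z.1)%R).
  by apply: (measurableT_comp mF); apply: measurable_fun_pair => //; apply: measurableT_comp.
apply: etrans (q F mF F0); apply: etrans (etrans (q _ mF' (fun z => F0 _)) _).
  by apply: eq_integral => x _; apply: eq_integral => y _; congr (F (_, _)) => /=; ring.
by apply: eq_integral => x _; apply: eq_integral => y _; congr (F (_, _)) => /=; ring.
Qed.

(** Completing the square turns the integrand into [expR (a ^+ 2 / 2)] times the density of the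
    normal law of mean [a]. *)
Lemma normal_mgf (a : R) : \int[gauss]_x (expR (a * x))%:E = (expR (a ^+ 2 / 2))%:E.
Proof.
rewrite integral_normalE//; last first.
  by apply/measurable_EFinP; apply: measurableT_comp => //; exact: measurable_funM.
under eq_integral => x _.
  rewrite (_ : _ * _ = (expR (a ^+ 2 / 2))%:E * (normal_pdf a 1 x)%:E).
    over.
  rewrite -!EFinM !normal_pdfE ?oner_eq0//= /normal_fun !(mulrCA _ (normal_peak 1)) -!expRD.
  by congr (_ * expR _)%:E; rewrite expr1n; field.
rewrite ge0_integralZl//.
- by rewrite integral_normal_pdf mule1.
- by apply/measurable_EFinP; exact: measurable_normal_pdf.
- by move=> x _; rewrite lee_fin normal_pdf_ge0.
Qed.

End plane_rotation.

(* Locked because unification would otherwise unfold [normal_prob]. *)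
Definition stdnormal (R : realType) : probability (measurableTypeR R) R :=
  locked (normal_prob 0 1 : probability (measurableTypeR R) R).

Lemma stdnormalE (R : realType) :
  stdnormal R = (normal_prob 0 1 : probability (measurableTypeR R) R).
Proof. by rewrite /stdnormal -lock. Qed.

Section standard_normal.
Context {R : realType}.
Local Notation N01 := (stdnormal R).
Local Open Scope ereal_scope.

Lemma stdnormal_rotation (c s : R) (F : R * R -> \bar R) : (c ^+ 2 + s ^+ 2 = 1)%R ->
  measurable_fun setT F -> (forall z, 0 <= F z) ->
  \int[N01]_x \int[N01]_y F (c * x + s * y, - s * x + c * y)%R
  = \int[N01]_x \int[N01]_y F (x, y).
Proof. rewrite stdnormalE; exact: ge0_integral_rotation. Qed.

Lemma stdnormal_mgf (a : R) : \int[N01]_x (expR (a * x))%:E = (expR (a ^+ 2 / 2))%:E.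
Proof. rewrite stdnormalE; exact: normal_mgf. Qed.

End standard_normal.

(** * Standard Gaussian vectors *)

Lemma integral_prob_cst d (T : measurableType d) (R : realType)
  (P : probability T R) (c : \bar R) : (\int[P]_x c = c)%E.
Proof. by rewrite integral_cst//= probability_setT mule1. Qed.

Definition tuple_cons (T : Type) n (z : T * n.-tuple T) : n.+1.-tuple T :=
  [tuple of z.1 :: z.2].

Lemma measurable_tuple_cons d (T : measurableType d) n :
  measurable_fun setT (@tuple_cons T n).
Proof. by apply: measurable_cons. Qed.

HB.instance Definition _ d (T : measurableType d) n :=
  isMeasurableFun.Build _ _ _ _ (@tuple_cons T n) (@measurable_tuple_cons d T n).

(** The law of [n] independent standard normal variables, built one coordinate at a time so that
    Tonelli allows induction on the dimension. *)
Fixpoint gaussn (R : realType) n : probability (n.-tuple (measurableTypeR R)) R :=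
  if n is m.+1 then distribution (stdnormal R \x gaussn R m)%E (@tuple_cons (measurableTypeR R) m)
  else \d_[tuple].

Section gaussn.
Context {R : realType}.
Local Notation N01 := (stdnormal R).
Local Notation G n := (gaussn R n).
Local Notation rV n := (n.-tuple (measurableTypeR R)).
Local Open Scope ereal_scope.

Lemma gaussnSE n (f : rV n.+1 -> \bar R) :
  measurable_fun setT f -> (forall v, 0 <= f v) ->
  \int[G n.+1]_v f v = \int[N01]_x \int[G n]_v f (tuple_cons (x, v)).
Proof.
move=> mf f0.
rewrite [LHS]ge0_integral_distribution// fubini_tonelli1//.
  by apply: measurableT_comp => //; exact: measurable_tuple_cons.
by move=> z; exact: f0.
Qed.
#[local] Opaque gaussn.

(** Each coordinate has its own pair [(c i, s i)], so that some coordinates can be rotated while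
    others are frozen with [c i = 1] and [s i = 0]. *)
Definition rotn (c s : nat -> R) n (z : rV n * rV n) : rV n :=
  [tuple (c i * tnth z.1 i + s i * tnth z.2 i)%R | i < n].

Lemma measurable_rotn c s n : measurable_fun setT (@rotn c s n).
Proof.
apply/measurable_fun_tnthP => i.
rewrite (_ : _ \o _ = fun z : rV n * rV n => c i * tnth z.1 i + s i * tnth z.2 i)%R; last first.
  by apply/funext => z /=; rewrite tnth_mktuple.
by apply: measurable_funD; apply: measurable_funM => //;
  apply: (measurableT_comp (measurable_tnth i)).
Qed.

Lemma rotn_cons c s n x (v : rV n) y (w : rV n) :
  rotn c s (tuple_cons (x, v), tuple_cons (y, w)) =
  tuple_cons (c 0%N * x + s 0%N * y, rotn (c \o S) (s \o S) (v, w))%R.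
Proof.
apply: eq_from_tnth => i; rewrite tnth_mktuple /=.
case: (unliftP ord0 i) => [j ->|->].
  by rewrite !tnthS tnth_mktuple.
by rewrite !tnth0.
Qed.

(** Tonelli moves the two leading coordinates to the outside, which is the form that the plane
    rotation needs in the induction below. *)
Lemma gaussn2SE n (F : rV n.+1 * rV n.+1 -> \bar R) :
  measurable_fun setT F -> (forall z, 0 <= F z) ->
  \int[G n.+1]_v \int[G n.+1]_w F (v, w) =
  \int[N01]_x \int[N01]_y \int[G n]_v \int[G n]_w
     F (tuple_cons (x, v), tuple_cons (y, w)).
Proof.
move=> mF F0.
rewrite gaussnSE//=; last 2 first.
- exact: measurable_fun_fubini_tonelli_F.
- by move=> v; apply: integral_ge0.
apply: eq_integral => x _.
transitivity (\int[G n]_v \int[N01]_y \int[G n]_w F (tuple_cons (x, v), tuple_cons (y, w))).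
  apply: eq_integral => v _; rewrite gaussnSE//.
  by apply: (measurableT_comp mF) => //; exact: pair1_measurable.
have mH : measurable_fun setT (fun z : rV n * measurableTypeR R * rV n =>
    F (tuple_cons (x, z.1.1), tuple_cons (z.1.2, z.2))).
  apply: (measurableT_comp mF); apply: measurable_fun_pair => /=.
  - apply: (measurableT_comp (measurable_tuple_cons (n:=n))); apply: measurable_fun_pair => //.
    by apply: measurableT_comp.
  - apply: (measurableT_comp (measurable_tuple_cons (n:=n))); apply: measurable_fun_pair => //.
    by apply: measurableT_comp.
pose K (z : rV n * measurableTypeR R) := \int[G n]_w F (tuple_cons (x, z.1), tuple_cons (z.2, w)).
apply: (fubini_tonelli (m1 := G n) (m2 := N01) K).
  exact: (measurable_fun_fubini_tonelli_F _ mH (fun z => F0 _)).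
by move=> z; apply: integral_ge0.
Qed.

(** Induction on [n]: the plane rotation acts on the two leading coordinates, and the induction
    hypothesis with shifted coefficients acts on the tails. *)
Lemma gaussn_rotation n (c s : nat -> R) (F : rV n * rV n -> \bar R) :
  (forall i, c i ^+ 2 + s i ^+ 2 = 1)%R ->
  measurable_fun setT F -> (forall z, 0 <= F z) ->
  \int[G n]_v \int[G n]_w F (rotn c s (v, w), rotn (fun i => - s i)%R c (v, w)) =
  \int[G n]_v \int[G n]_w F (v, w).
Proof.
elim: n c s F => [|n IH] c s F cs mF F0.
  apply: eq_integral => v _; apply: eq_integral => w _.
  by congr (F (_, _)); rewrite [LHS]tuple0 [RHS]tuple0.
rewrite [RHS]gaussn2SE//.
have mR : measurable_fun setT (fun z : rV n.+1 * rV n.+1 => F (rotn c s z, rotn (fun i => - s i)%R c z)).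
  by apply: (measurableT_comp mF); apply: measurable_fun_pair; exact: measurable_rotn.
rewrite (gaussn2SE mR (fun z => F0 _)).
pose I (z : R * R) := \int[G n]_v \int[G n]_w F (tuple_cons (z.1, v), tuple_cons (z.2, w)).
have mI : measurable_fun setT I.
  have mH : measurable_fun setT (fun z : (R * R) * rV n * rV n =>
      F (tuple_cons (z.1.1.1, z.1.2), tuple_cons (z.1.1.2, z.2))).
    apply: (measurableT_comp mF); apply: measurable_fun_pair => /=.
    - apply: (measurableT_comp (@measurable_tuple_cons _ _ n)); apply: measurable_fun_pair;
        by do 2?apply: measurableT_comp.
    - apply: (measurableT_comp (@measurable_tuple_cons _ _ n)); apply: measurable_fun_pair;
        by do 2?apply: measurableT_comp.
  have mH' := measurable_fun_fubini_tonelli_F (m2 := G n) _ mH (fun z => F0 _).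
  apply: (measurable_fun_fubini_tonelli_F (m2 := G n) _ mH').
  by move=> z; apply: integral_ge0.
have I0 z : 0 <= I z by apply: integral_ge0 => v _; apply: integral_ge0.
apply: etrans (stdnormal_rotation (cs 0%N) mI I0).
apply: eq_integral => x _; apply: eq_integral => y _.
under eq_integral do under eq_integral do rewrite !rotn_cons.
apply: (IH (c \o S) (s \o S) (fun z => F (tuple_cons (_, z.1), tuple_cons (_, z.2)))) => //.
- by move=> i; exact: cs.
- apply: (measurableT_comp mF); apply: measurable_fun_pair => /=.
  - by apply: (measurableT_comp (@measurable_tuple_cons _ _ n)); apply: measurable_fun_pair.
  - by apply: (measurableT_comp (@measurable_tuple_cons _ _ n)); apply: measurable_fun_pair.
Qed.

Definition linform (al : nat -> R) n (v : rV n) : R := (\sum_(i < n) al i * tnth v i)%R.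

Lemma measurable_linform al n : measurable_fun setT (@linform al n).
Proof.
apply: measurable_sum => i; apply: measurable_funM => //; exact: measurable_tnth.
Qed.

Lemma linform_cons al n x (v : rV n) :
  linform al (tuple_cons (x, v)) = (al 0%N * x + linform (al \o S) v)%R.
Proof.
rewrite /linform big_ord_recl tnth0; congr (_ + _)%R.
by apply: eq_bigr => i _; rewrite tnthS.
Qed.

(** By induction the tail acts as [Num.sqrt q * y]. The sum [al 0 * x + Num.sqrt q * y] is [r] times
    the first coordinate of a rotated Gaussian pair, with cosine [al 0 / r] and sine
    [Num.sqrt q / r]; when [r = 0] both coefficients vanish. *)
Lemma gaussn_linform al n (f : R -> \bar R) :
  measurable_fun setT f -> (forall x, 0 <= f x) ->
  \int[G n]_v f (linform al v) =
  \int[N01]_x f (Num.sqrt (\sum_(i < n) al i ^+ 2) * x)%R.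
Proof.
elim: n al f => [|n IH] al f mf f0.
  under eq_integral do rewrite /linform big_ord0.
  under [RHS]eq_integral do rewrite big_ord0 sqrtr0 mul0r.
  by rewrite (integral_prob_cst (G 0)) (integral_prob_cst N01).
rewrite gaussnSE//; last by apply: measurableT_comp => //; exact: measurable_linform.
under eq_integral do under eq_integral do rewrite linform_cons.
rewrite big_ord_recl; set q := (\sum_(i < n) _)%R.
have q0 : (0 <= q)%R by apply: sumr_ge0 => i _; exact: sqr_ge0.
transitivity (\int[N01]_x \int[N01]_y f (al 0%N * x + Num.sqrt q * y)%R).
  apply: eq_integral => x _; apply: (IH (al \o S) (fun y => f (al 0%N * x + y)%R)) => //.
  by apply: measurableT_comp => //; exact: measurable_funD.
set r := Num.sqrt (al ord0 ^+ 2 + q)%R.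
have rE : (r ^+ 2 = al 0%N ^+ 2 + q)%R by rewrite sqr_sqrtr// addr_ge0// sqr_ge0.
have [r0|r0] := eqVneq r 0%R.
  move: rE; rewrite r0 expr0n/= => /esym/eqP; rewrite paddr_eq0 ?sqr_ge0// sqrf_eq0 => /andP[/eqP -> /eqP ->].
  under eq_integral do under eq_integral do rewrite sqrtr0 !mul0r addr0.
  under [RHS]eq_integral do rewrite mul0r.
  by rewrite !integral_prob_cst.
have cs : ((al 0%N / r) ^+ 2 + (Num.sqrt q / r) ^+ 2 = 1)%R.
  by rewrite !expr_div_n (sqr_sqrtr q0) -mulrDl -rE divff// sqrf_eq0.
transitivity (\int[N01]_x \int[N01]_y f (r * x)%R); last first.
  by apply: eq_integral => x _; rewrite integral_prob_cst.
apply: etrans (stdnormal_rotation cs (F := fun z : R * R => f (r * z.1)%R) _ _) => //.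
- apply: eq_integral => x _; apply: eq_integral => y _ /=.
  by congr f; field.
- by apply: measurableT_comp => //; exact: measurable_funM.
Qed.

Lemma gaussn_mgf al n : \int[G n]_v (expR (linform al v))%:E =
  (expR ((\sum_(i < n) al i ^+ 2) / 2))%:E.
Proof.
rewrite (gaussn_linform al n (f := fun x => (expR x)%:E))//.
  by rewrite stdnormal_mgf sqr_sqrtr// sumr_ge0// => i _; exact: sqr_ge0.
by apply/measurable_EFinP.
Qed.

End gaussn.

(** * Law of the coefficients *)

Section law.
Context {R : realType}.
Local Notation N01 := (stdnormal R).
Local Notation rV n := (n.-tuple (measurableTypeR R)).
Local Open Scope ereal_scope.

Definition tuple_box n (E : nat -> set R) : set (rV n) :=
  [set v | forall i : 'I_n, E i (tnth v i)].
#[local] Arguments tuple_box : clear implicits.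

Lemma measurable_tuple_box n (E : nat -> set R) : (forall k, measurable (E k)) ->
  measurable (tuple_box n E).
Proof.
move=> mE; rewrite (_ : tuple_box n E = \bigcap_(i in [set: 'I_n]) ((fun v => tnth v i) @^-1` E i)).
  apply: fin_bigcap_measurable; [exact: finite_finset|move=> i _]; rewrite -[X in measurable X]setTI.
  exact: (@measurable_tnth _ (measurableTypeR R) n i measurableT _ (mE i)).
by apply/seteqP; split => v /= h i; [move=> _|]; exact: h.
Qed.

Lemma gaussn_tuple_box n (E : nat -> set R) : (forall k, measurable (E k)) ->
  gaussn R n (tuple_box n E) = \prod_(k < n) N01 (E k).
Proof.
elim: n E => [|n IH] E mE.
  by rewrite big_ord0 /= diracE mem_set// => -[].
rewrite big_ord_recl.
transitivity ((N01 \x gaussn R n) (E 0%N `*` tuple_box n (E \o S))).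
  have -> // : E 0%N `*` tuple_box n (E \o S) = @tuple_cons (measurableTypeR R) n @^-1` tuple_box n.+1 E.
  apply/seteqP; split => [[x v]|[x v]] /=.
    move=> [/= h0 h] i; case: (unliftP ord0 i) => [j ->|->]; last by rewrite tnth0.
    by rewrite tnthS; exact: h.
  move=> h; split; first by have := h ord0; rewrite tnth0.
  by move=> i /=; have := h (lift ord0 i); rewrite tnthS.
have mb : measurable (tuple_box n (E \o S)) by apply: measurable_tuple_box => k; exact: mE.
have e := product_measure1E N01 (gaussn R n) (mE 0%N) mb. rewrite [LHS]e.
by congr (_ * _); apply: IH => k; exact: mE.
Qed.

Lemma measurable_tuple_boxes n : @measurable _ (rV n) =
  <<s [set B | exists2 E : nat -> set R, (forall k, measurable (E k)) & B = tuple_box n E] >>.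
Proof.
apply/seteqP; split; last first.
  apply: smallest_sub; first exact: sigma_algebra_measurable.
  by move=> _ [E mE ->]; exact: measurable_tuple_box.
apply: smallest_sub; first exact: smallest_sigma_algebra.
apply: (@subset_trans _ [set B | exists2 E : nat -> set R, (forall k, measurable (E k)) & B = tuple_box n E]); last exact: sub_sigma_algebra.
elim/big_ind: _ => [//|A B hA hB x [/hA|/hB]//|i _].
move=> _ [B mB <-].
exists (fun k => if k == i :> nat then B else setT).
  by move=> k; case: ifP.
apply/seteqP; split=> v /=.
  by move=> [_ Bv] j; case: ifPn => // /eqP/val_inj ->.
by move=> /(_ i); rewrite eqxx.
Qed.

(** Boxes are stable under intersection and generate the product sigma-algebra, so a measure is
    determined by its values on them. *)
Lemma gaussn_unique n (m : {measure set (rV n) -> \bar R}) :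
  (forall E : nat -> set R, (forall k, measurable (E k)) ->
     m (tuple_box n E) = \prod_(k < n) N01 (E k)) ->
  forall A, measurable A -> m A = gaussn R n A.
Proof.
move=> mE A mA; apply/esym.
apply: (measure_unique [set B | exists2 E : nat -> set R, (forall k, measurable (E k)) & B = tuple_box n E]
  (fun=> setT)) => //.
- exact: measurable_tuple_boxes.
- move=> _ _ [E mE1 ->] [F mF ->]; exists (fun k => E k `&` F k).
    by move=> k; exact: measurableI.
  apply/seteqP; split=> v /=; first by move=> [h1 h2] i; split.
  by move=> h; split => i; have [] := h i.
- by move=> _; exists (fun=> setT) => //; apply/seteqP; split.
- by apply/seteqP; split => // v _; exists 0%N.
- by move=> _ [E mE1 ->]; rewrite mE//; exact: gaussn_tuple_box.
- by move=> _; exact: le_lt_trans (probability_le1 (gaussn R n) measurableT) (ltry _).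
Qed.

Context d (T : measurableType d) (P : probability T R).

Definition tuple_of_family n (c : nat -> {RV P >-> R}) (w : T) : rV n :=
  [tuple c i w | i < n].

Lemma measurable_tuple_of_family n c : measurable_fun setT (@tuple_of_family n c).
Proof.
apply/measurable_fun_tnthP => i.
rewrite (_ : _ \o _ = c i); last by apply/funext => w /=; rewrite tnth_mktuple.
exact: (@measurable_funPT _ _ _ _ (c i)).
Qed.

Lemma tuple_of_family_law n (c : nat -> {RV P >-> R}) :
  (forall E : nat -> set R, (forall k, measurable (E k)) ->
     P [set w | forall i : 'I_n, E i (c i w)] = \prod_(k < n) N01 (E k)) ->
  forall A, measurable A -> P (@tuple_of_family n c @^-1` A) = gaussn R n A.
Proof.
move=> cE A mA.
have mc := @measurable_tuple_of_family n c.
pose phi : {mfun T >-> rV n} := HB.pack (@tuple_of_family n c) (isMeasurableFun.Build _ _ _ _ _ mc).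
rewrite -(gaussn_unique (m := distribution P phi))// => E mE.
rewrite -cE//; congr (P _).
by apply/seteqP; split => w /= h i; have := h i; rewrite tnth_mktuple.
Qed.

(** Brings events about finitely many coordinates within the scope of [independent_families]; [f]
    absorbs the shift between positions in a tuple and indices of the family. *)
Lemma sigma_of_family_fin (D : set nat) (X : nat -> {RV P >-> R}) (n : nat) (f : nat -> nat) (E : nat -> set R) :
  (forall k, measurable (E k)) -> (forall k, D (f k)) ->
  sigma_of_family D X [set w | forall i : 'I_n, E i (X (f i) w)].
Proof.
move=> mE Df; rewrite /sigma_of_family; set H := \bigcup_(k in D) _.
rewrite (_ : [set w | _] = \bigcap_(i in [set: 'I_n]) (X (f i) @^-1` E i)); last first.
  by apply/seteqP; split => v /= h i; [move=> _|]; exact: h.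
apply: (@fin_bigcap_measurable _ (g_sigma_algebraType H)); [exact: finite_finset|move=> i _].
apply: sub_sigma_algebra; exists (f i) => //; exists (E i) => //.
by rewrite setTI.
Qed.

Lemma iid_standard_normal_fin (X : nat -> {RV P >-> R}) (n : nat) (E : nat -> set R) :
  iid_standard_normal [set k | (1 <= k)%N] X ->
  (forall k, measurable (E k)) ->
  P [set w | forall i : 'I_n, E i (X i.+1 w)] = \prod_(k < n) N01 (E k).
Proof.
move=> [indX lawX] mE.
(* The sequence starts at index 1 while the tuple starts at position 0, hence the predecessor in
   [E k.-1]. *)
transitivity (P (\bigcap_(k in [set` iota 1 n]) (X k @^-1` E k.-1))).
  congr (P _); apply/seteqP; split => w /= h.
    move=> k /=; rewrite mem_iota add1n => /andP[k0 kn].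
    have kn' : (k.-1 < n)%N by rewrite prednK// ltnW.
    by have := h (Ordinal kn'); rewrite /= prednK.
  move=> i; apply: (h i.+1); rewrite /= mem_iota add1n !ltnS leq0n/=; exact: ltn_ord.
rewrite indX ?iota_uniq//; last by move=> k /=; rewrite mem_iota => /andP[].
rewrite -(big_mkord xpredT (fun k => N01 (E k))) /index_iota subn0.
rewrite (iotaDl 1 0) big_map; apply: eq_bigr => k _.
by rewrite add1n /= stdnormalE; exact: (lawX k.+1 isT _ (mE k)).
Qed.

(** The first [n] positions hold [g 1, ..., g n] and the last [n] hold [g' 1, ..., g' n]. On a box
    the event splits into one event per family, and independence gives the product. *)
Lemma joint_normal_law (g g' : nat -> {RV P >-> R}) (n : nat) :
  iid_standard_normal [set k | (1 <= k)%N] g ->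
  iid_standard_normal [set k | (1 <= k)%N] g' ->
  independent_families [set k | (1 <= k)%N] g g' ->
  forall A, measurable A ->
  P (@tuple_of_family (n + n) (fun k => if (k < n)%N then g k.+1 else g' (k - n).+1) @^-1` A)
  = gaussn R (n + n) A.
Proof.
move=> ig ig' indep; apply: tuple_of_family_law => E mE.
pose F k := E (n + k)%N.
have mF k : measurable (F k) by exact: mE.
transitivity (P ([set w | forall i : 'I_n, E i (g i.+1 w)] `&`
                 [set w | forall i : 'I_n, F i (g' i.+1 w)])).
  congr (P _); apply/seteqP; split => w /= h.
    split=> i; first by have := h (lshift n i); rewrite /= ltn_ord.
    by have := h (rshift n i); rewrite /= ltnNge leq_addr/= addKn.
  move=> i; case: ltnP => ni; first exact: (h.1 (Ordinal ni)).
  have ni' : (i - n < n)%N by rewrite ltn_subLR.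
  by have := h.2 (Ordinal ni'); rewrite /F /= subnKC.
rewrite indep; [|exact: (sigma_of_family_fin _ (f := S))..].
by rewrite (iid_standard_normal_fin n ig mE) (iid_standard_normal_fin n ig' mF) big_split_ord.
Qed.

End law.

(** * Concentration of averaged hinge functions *)

Section average.
Context {R : realType}.

Definition avg N (e : 'I_N -> R) : R := N%:R^-1 * \sum_(i < N) e i.

Lemma ler_avg N (e f : 'I_N -> R) : (forall i, e i <= f i) -> avg e <= avg f.
Proof. by move=> ef; rewrite /avg ler_wpM2l ?invr_ge0// ler_sum. Qed.

Lemma avg_cst N (c : R) : (0 < N)%N -> avg (fun _ : 'I_N => c) = c.
Proof.
move=> N0; rewrite /avg sumr_const card_ord -[c *+ N]mulr_natl mulrA mulVf ?mul1r//.
by rewrite pnatr_eq0 -lt0n.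
Qed.

Lemma avgD N (e f : 'I_N -> R) : avg (fun i => e i + f i) = avg e + avg f.
Proof. by rewrite /avg big_split mulrDr. Qed.

Lemma avgB N (e f : 'I_N -> R) : avg (fun i => e i - f i) = avg e - avg f.
Proof. by rewrite /avg sumrB mulrBr. Qed.

Lemma avgZ N (c : R) (e : 'I_N -> R) : avg (fun i => c * e i) = c * avg e.
Proof. by rewrite /avg -mulr_sumr mulrCA. Qed.

Lemma expR_avg N (e : 'I_N -> R) : (0 < N)%N -> expR (avg e) <= avg (fun i => expR (e i)).
Proof.
(* Jensen's inequality: the exponential lies above its tangent at [avg e], and the linear terms
   cancel on averaging. *)
move=> N0; have h i : expR (avg e) * (1 - avg e) + expR (avg e) * e i <= expR (e i).
  have -> : expR (e i) = expR (avg e) * expR (e i - avg e) by rewrite -expRD addrC subrK.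
  rewrite -mulrDr ler_wpM2l ?expR_ge0//.
  by rewrite addrAC -addrA; exact: expR_ge1Dx.
apply: le_trans (ler_avg h); rewrite avgD avg_cst// avgZ -mulrDr subrK mulr1. exact: lexx.
Qed.

Definition hinge (z x : R) : R := Num.max (x - z) 0.

Lemma hinge_ge0 z x : 0 <= hinge z x. Proof. by rewrite le_max lexx orbT. Qed.

Lemma hinge_le0 z x : x <= z -> hinge z x = 0.
Proof. by move=> xz; apply/max_idPr; rewrite subr_le0. Qed.

Lemma measurable_hinge z : measurable_fun setT (hinge z).
Proof. by apply: measurable_maxr => //; exact: measurable_funB. Qed.

(** The indicator of [z < x] is a subgradient of the hinge at [x]. *)
Lemma hinge_convex z x y : hinge z x - hinge z y <= (z < x)%R%:R * (x - y).
Proof.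
case: ltP => zx.
  rewrite mul1r {1}/hinge (max_idPl _); last by rewrite subr_ge0 ltW.
  have : y - z <= hinge z y by rewrite le_max lexx.
  lra.
rewrite mul0r (hinge_le0 zx) sub0r oppr_le0; exact: hinge_ge0.
Qed.

Lemma hinge_avg N z (e : 'I_N -> R) : (0 < N)%N -> hinge z (avg e) <= avg (fun i => hinge z (e i)).
Proof.
move=> N0; rewrite /hinge ge_max; apply/andP; split.
  apply: (@le_trans _ _ (avg (fun i => e i - z))).
    by rewrite avgD avg_cst.
  by apply: ler_avg => i; rewrite le_max lexx.
by rewrite mulr_ge0 ?invr_ge0// sumr_ge0// => i _; exact: hinge_ge0.
Qed.

End average.

(** * Bounds for sine and cosine at small angles *)

Section sine.
Context {R : realType}.

Lemma sin_le (x : R) : 0 <= x -> sin x <= x.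
Proof.
move=> x0; have [c _] := @MVT_segment R sin cos 0 x x0 (fun y _ => is_derive_sin y)
  (continuous_subspaceT (@continuous_sin R)).
rewrite sin0 !subr0 => ->.
by rewrite -[leRHS]mul1r ler_wpM2r// cos_le1.
Qed.

Lemma sin_ge (x : R) : 0 <= x -> - x <= sin x.
Proof.
move=> x0; have [c _] := @MVT_segment R sin cos 0 x x0 (fun y _ => is_derive_sin y)
  (continuous_subspaceT (@continuous_sin R)).
rewrite sin0 !subr0 => ->.
by rewrite -mulN1r ler_wpM2r// cos_geN1.
Qed.

Lemma sqr_sin_le (x : R) : 0 <= x -> sin x ^+ 2 <= x ^+ 2.
Proof.
move=> x0; rewrite -[leLHS]real_normK ?num_real// -[leRHS]real_normK ?num_real//.
by rewrite lerXn2r ?nnegrE// [leRHS]ger0_norm// ler_norml sin_le// sin_ge.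
Qed.

Lemma onem_cos_le (x : R) : 0 <= x -> 1 - cos x <= x ^+ 2 / 2.
Proof.
move=> x0; have -> : 1 - cos x = 2 * sin (x / 2) ^+ 2.
  have -> : cos x = cos (x / 2 + x / 2) by congr cos; field.
  have := cos2Dsin2 (x / 2); rewrite cosD; lra.
have := @sqr_sin_le (x / 2); rewrite divr_ge0// => /(_ isT).
rewrite expr_div_n; lra.
Qed.

End sine.

(** * Maurey-Pisier interpolation between a Gaussian vector and its partial copy *)

Section concentration.
Context {R : realType}.
Local Notation N01 := (stdnormal R).
Local Notation G n := (gaussn R n).
Local Notation rV n := (n.-tuple (measurableTypeR R)).

(** The row [w i] gives the value of the process at the [i]-th grid point as a linear form in the
    Gaussian vector. [S] selects the coordinates to be rotated; the others are frozen. [kappa] is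
    the Bessel bound and [mu] the lower bound on the mean. *)
Variables (n N : nat) (w : 'I_N -> nat -> R) (S : pred nat) (z sigma kappa mu : R).
Hypothesis N0 : (0 < N)%N.
Hypothesis sigma0 : 0 <= sigma.
Hypothesis avg_big : forall k, (k < n)%N -> ~~ S k -> avg (w ^~ k) = 0.
Hypothesis var_small : forall i, \sum_(k < n | S k) w i k ^+ 2 = sigma ^+ 2.
Hypothesis bessel_small : forall s : 'I_N -> R, (forall i, 0 <= s i <= 1) ->
  \sum_(k < n | S k) avg (fun i => s i * w i k) ^+ 2 <= kappa.
Hypothesis mean_hinge : (mu%:E <= \int[N01]_x (hinge z (sigma * x))%:E)%E.

Hypothesis mu0 : 0 <= mu.

Let wS (i : 'I_N) (k : nat) : R := if S k then w i k else 0.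
Let wB (i : 'I_N) (k : nat) : R := if S k then 0 else w i k.
Let cS (th : R) (k : nat) : R := if S k then cos th else 1.
Let sS (th : R) (k : nat) : R := if S k then sin th else 0.

Let csS th k : cS th k ^+ 2 + sS th k ^+ 2 = 1.
Proof. by rewrite /cS /sS; case: ifP => _; rewrite ?cos2Dsin2// expr1n expr0n addr0. Qed.

Let F (v : rV n) : R := avg (fun i => hinge z (linform (w i) v)).

Let measurable_F : measurable_fun setT F.
Proof.
apply: measurable_funM => //; apply: measurable_sum => i.
by apply: measurableT_comp; [exact: measurable_hinge|exact: measurable_linform].
Qed.

Let linf_rotS th i (v v' : rV n) :
  linform (w i) (rotn (cS th) (fun k => - sS th k) (v, v')) =
  linform (w i) v - ((1 - cos th) * linform (wS i) v + sin th * linform (wS i) v').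
Proof.
rewrite /linform !mulr_sumr -big_split -sumrB; apply: eq_bigr => k _.
rewrite tnth_mktuple /wS /cS /sS /=; case: ifP => _; ring.
Qed.

Let linf_mix i (v v' : rV n) :
  linform (w i) (rotn (cS (pi / 2)) (sS (pi / 2)) (v, v')) = linform (wB i) v + linform (wS i) v'.
Proof.
rewrite /linform -big_split; apply: eq_bigr => k _.
rewrite tnth_mktuple /wS /wB /cS /sS /=; case: ifP => _; rewrite ?cos_pihalf ?sin_pihalf; ring.
Qed.

(** The point at angle [a] and its companion form a pair with the law of [(v, v')]. In terms of that
    pair, stepping back by [th] is the same map for every [a], so all steps along the path have the
    same law. *)
Let rotS_sub a th (v v' : rV n) :
  rotn (cS th) (fun k => - sS th k)
    (rotn (cS a) (sS a) (v, v'), rotn (fun k => - sS a k) (cS a) (v, v')) =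
  rotn (cS (a - th)) (sS (a - th)) (v, v').
Proof.
apply: eq_from_tnth => i; rewrite !tnth_mktuple /=.
rewrite /cS /sS; case: ifP => _; last ring.
rewrite cosB sinB; ring.
Qed.

Let sqr_wS i : \sum_(k < n) wS i k ^+ 2 = sigma ^+ 2.
Proof.
rewrite -(var_small i) [RHS]big_mkcond; apply: eq_bigr => k _.
by rewrite /wS; case: ifP => _//; rewrite expr0n.
Qed.

(** The subgradient inequality is applied at [v]. The part of the increment along [v] is of second
    order in [th] and is bounded in absolute value; the first-order part is linear in [v'], with
    coefficients depending on [v] only. *)
Let F_sub th (v v' : rV n) :
  F v - F (rotn (cS th) (fun k => - sS th k) (v, v')) <=
  (1 - cos th) * avg (fun i => `|linform (wS i) v|) +
  linform (fun k => sin th * avg (fun i => (z < linform (w i) v)%R%:R * wS i k)) v'.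
Proof.
have -> : linform (fun k => sin th * avg (fun i => (z < linform (w i) v)%R%:R * wS i k)) v' =
    avg (fun i => (z < linform (w i) v)%R%:R * (sin th * linform (wS i) v')).
  rewrite /linform /avg.
  under eq_bigr do rewrite mulrCA mulr_sumr -!mulrA mulr_suml.
  rewrite -mulr_sumr exchange_big /=; congr (_ * _); apply: eq_bigr => i _.
  by rewrite !mulr_sumr; apply: eq_bigr => k _; ring.
rewrite -avgZ -avgD /F -avgB; apply: ler_avg => i.
apply: le_trans (hinge_convex _ _ _) _; rewrite linf_rotS opprB addrCA subrr addr0 mulrDr lerD2r.
have c0 : 0 <= 1 - cos th by rewrite subr_ge0 cos_le1.
case: (z < _); rewrite ?mul1r ?mul0r ?mulr_ge0//.
by rewrite ler_wpM2l// ler_norm.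
Qed.


Local Open Scope ereal_scope.

Lemma gaussn2_rotation (c s : nat -> R) (H : rV n * rV n -> \bar R) :
  (forall i, c i ^+ 2 + s i ^+ 2 = 1)%R ->
  measurable_fun setT H -> (forall z, 0 <= H z) ->
  \int[G n \x G n]_z H (rotn c s z, rotn (fun i => - s i)%R c z) =
  \int[G n \x G n]_z H z.
Proof.
move=> cs mH H0.
have mR : measurable_fun setT (fun z : rV n * rV n => H (rotn c s z, rotn (fun i => - s i)%R c z)).
  by apply: (measurableT_comp mH); apply: measurable_fun_pair; exact: measurable_rotn.
apply: etrans (fubini_tonelli1 _ mR (fun z => H0 _)) _.
apply: etrans _ (esym (fubini_tonelli1 _ mH H0)).
exact: gaussn_rotation.
Qed.

(** Jensen's inequality moves the exponential inside the average, and the exponential of an absolute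
    value is at most the sum of the exponentials of both signs, which gives the factor 2. *)
Let exp_abs (e : R) : (0 <= e)%R ->
  \int[G n]_v (expR (e * avg (fun i => `|linform (wS i) v|)))%:E
  <= (2 * expR (e ^+ 2 * sigma ^+ 2 / 2))%:E.
Proof.
move=> e0.
pose f i (v : rV n) := (expR (linform (fun k => e * wS i k)%R v) + expR (linform (fun k => - e * wS i k)%R v))%R.
have linfZ (c : R) i v : linform (fun k => c * wS i k)%R v = (c * linform (wS i) v)%R.
  by rewrite /linform mulr_sumr; apply: eq_bigr => k _; rewrite mulrA.
have mexp al : measurable_fun setT (fun v : rV n => (expR (linform al v))%:E).
  by apply/measurable_EFinP; apply: measurableT_comp => //; exact: measurable_linform.
have mf i : measurable_fun setT (fun v => (f i v)%:E).
  by under eq_fun do rewrite EFinD; apply: emeasurable_funD; exact: mexp.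
have f0 i v : (0 <= f i v)%R by rewrite addr_ge0 ?expR_ge0.
apply: (@le_trans _ _ (\int[G n]_v ((N%:R^-1)%:E * \sum_(i < N) (f i v)%:E))).
  apply: ge0_le_integral => //.
  - apply/measurable_EFinP; apply: measurableT_comp => //; apply: measurable_funM => //.
    apply: measurable_funM => //; apply: measurable_sum => i.
    by apply: measurableT_comp => //; exact: measurable_linform.
  - by apply: measurable_funeM; exact: emeasurable_sum.
  - move=> v _; rewrite sumEFin -EFinM lee_fin -avgZ.
    apply: le_trans (expR_avg _ N0) _; apply: ler_avg => i; rewrite /f !linfZ.
    have [h|h] := ger0P (linform (wS i) v); first by rewrite lerDl expR_ge0.
    by rewrite mulrN -mulNr lerDr expR_ge0.
rewrite ge0_integralZl//; last 2 first.
- exact: emeasurable_sum.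
- by move=> v _; apply: sume_ge0 => i _; rewrite lee_fin.
rewrite ge0_integral_sum//; last by move=> i v _; rewrite lee_fin.
rewrite (eq_bigr (fun=> (2 * expR (e ^+ 2 * sigma ^+ 2 / 2))%:E)); last first.
  move=> i _; under eq_integral do rewrite EFinD; rewrite ge0_integralD//.
  have sq (c : R) : (\sum_(k < n) (c * wS i k) ^+ 2 = c ^+ 2 * sigma ^+ 2)%R.
    by rewrite -(sqr_wS i) mulr_sumr; apply: eq_bigr => k _; rewrite exprMn.
  by rewrite !gaussn_mgf !sq sqrrN -EFinD mulr_natl mulr2n.
by rewrite sumEFin -EFinM lee_fin -[leLHS]/(avg _) avg_cst.
Qed.

(** For fixed [v] the bound of [F_sub] is linear in [v'], so the integral over [v'] is a Gaussian
    moment generating function whose variance is controlled by [bessel_small]. The remaining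
    integral over [v] is [exp_abs]. *)
Let step (t th : R) : (0 <= t)%R ->
  \int[G n \x G n]_x (expR (t * (F x.1 - F (rotn (cS th) (fun k => - sS th k)%R x))))%:E
  <= (2 * expR (t ^+ 2 * (1 - cos th) ^+ 2 * sigma ^+ 2 / 2 + t ^+ 2 * sin th ^+ 2 * kappa / 2))%:E.
Proof.
move=> t0.
have c0 : (0 <= 1 - cos th)%R by rewrite subr_ge0 cos_le1.
pose H (x : rV n * rV n) := (expR (t * (F x.1 - F (rotn (cS th) (fun k => - sS th k)%R x))))%:E.
have mH : measurable_fun setT H.
  apply/measurable_EFinP; apply: measurableT_comp => //; apply: measurable_funM => //.
  apply: measurable_funB; first exact: measurableT_comp.
  by apply: (measurableT_comp measurable_F); exact: measurable_rotn.
have H0 x : 0 <= H x by rewrite lee_fin expR_ge0.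
apply: (@le_trans _ _ (\int[G n]_v \int[G n]_v' H (v, v'))).
  by rewrite (fubini_tonelli1 _ mH H0).
pose K := expR (t ^+ 2 * sin th ^+ 2 * kappa / 2).
have mE : measurable_fun setT (fun v : rV n => (expR (t * (1 - cos th) * avg (fun i => `|linform (wS i) v|)))%:E).
  apply/measurable_EFinP; apply: measurableT_comp => //; apply: measurable_funM => //.
  apply: measurable_funM => //; apply: measurable_sum => i.
  by apply: measurableT_comp => //; exact: measurable_linform.
apply: (@le_trans _ _ (\int[G n]_v (K%:E * (expR (t * (1 - cos th) * avg (fun i => `|linform (wS i) v|)))%:E))).
  apply: ge0_le_integral => //.
  - by move=> v _; apply: integral_ge0.
  - exact: measurable_fun_fubini_tonelli_F.
  - exact: measurable_funeM.
  move=> v _.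
  pose be k := (t * (sin th * avg (fun i => (z < linform (w i) v)%R%:R * wS i k)))%R.
  apply: (@le_trans _ _ (\int[G n]_v' ((expR (t * (1 - cos th) * avg (fun i => `|linform (wS i) v|)))%:E
      * (expR (linform be v'))%:E))).
    apply: ge0_le_integral => //.
    - exact: (measurableT_comp mH (pair1_measurable v)).
    - apply: measurable_funeM; apply/measurable_EFinP; apply: measurableT_comp => //; exact: measurable_linform.
    move=> v' _; rewrite -EFinM lee_fin -expRD ler_expR/=.
    have -> : linform be v' = (t * linform (fun k => sin th * avg (fun i => (z < linform (w i) v)%R%:R * wS i k)) v')%R.
      by rewrite /linform mulr_sumr; apply: eq_bigr => k _; rewrite /be -!mulrA.
    by apply: le_trans (ler_wpM2l t0 (F_sub th v v')) _; rewrite mulrDr mulrA.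
  rewrite ge0_integralZl//; last first.
    by apply/measurable_EFinP; apply: measurableT_comp => //; exact: measurable_linform.
  rewrite gaussn_mgf muleC -!EFinM lee_fin ler_wpM2r ?expR_ge0// ler_expR.
  rewrite ler_pM2r ?invr_gt0// /be.
  have -> : (\sum_(k < n) (t * (sin th * avg (fun i => (z < linform (w i) v)%R%:R * wS i k))) ^+ 2 =
    t ^+ 2 * sin th ^+ 2 * \sum_(k < n | S k) avg (fun i => (z < linform (w i) v)%R%:R * w i k)^+2)%R.
    rewrite [in RHS]big_mkcond mulr_sumr; apply: eq_bigr => k _; rewrite /wS; case: ifP => _.
      by rewrite !exprMn mulrA.
    rewrite (_ : (fun i : 'I_N => _) = fun=> 0%R); last by apply/funext => i; rewrite mulr0.
    by rewrite avg_cst// !mulr0 expr0n.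
  apply: ler_wpM2l; first by rewrite mulr_ge0 ?sqr_ge0.
  apply: bessel_small => i.
  by rewrite ler0n/= lern1 leq_b1.
rewrite ge0_integralZl//; last by rewrite lee_fin expR_ge0.
apply: (@le_trans _ _ (K%:E * (2 * expR ((t * (1 - cos th)) ^+ 2 * sigma ^+ 2 / 2))%:E)).
  by apply: lee_wpmul2l; [rewrite lee_fin expR_ge0|apply: exp_abs; rewrite mulr_ge0].
by rewrite -EFinM lee_fin mulrCA -expRD addrC exprMn.
Qed.


Let mix (x : rV n * rV n) := rotn (cS (pi / 2)) (sS (pi / 2)) x.

Let measurable_Frot c s : measurable_fun setT (fun x : rV n * rV n => F (rotn c s x)).
Proof. by apply: (measurableT_comp measurable_F); exact: measurable_rotn. Qed.

Let rot0 x : rotn (cS 0) (sS 0) x = x.1 :> rV n.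
Proof.
apply: eq_from_tnth => i; rewrite tnth_mktuple /cS /sS cos0 sin0.
by case: ifP => _; rewrite mul1r mul0r addr0.
Qed.

(** The quarter turn is cut into [m] steps of angle [th]. As [t = lam * m], the total increment
    times [lam] is the average of the step increments times [t]; Jensen's inequality then reduces
    the claim to a single step. *)
Let exp_chain (m : nat) (lam t th : R) : (0 < m)%N -> (0 <= lam)%R ->
  t = (lam * m%:R)%R -> th = (pi / 2 / m%:R)%R ->
  \int[G n \x G n]_x (expR (lam * (F (mix x) - F x.1)))%:E
  <= (2 * expR (t ^+ 2 * (1 - cos th) ^+ 2 * sigma ^+ 2 / 2 + t ^+ 2 * sin th ^+ 2 * kappa / 2))%:E.
Proof.
move=> m0 lam0 tE thE; set B := (2 * _)%R.
have mR0 : (m%:R != 0 :> R)%R by rewrite pnatr_eq0 -lt0n.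
have t0 : (0 <= t)%R by rewrite tE mulr_ge0.
pose A (j : nat) (x : rV n * rV n) : rV n := rotn (cS (j%:R * th)) (sS (j%:R * th)) x.
pose D (j : nat) x := (expR (t * (F (A j.+1 x) - F (A j x))))%:E.
have mD j : measurable_fun setT (D j).
  apply/measurable_EFinP; apply: measurableT_comp => //; apply: measurable_funM => //.
  by apply: measurable_funB; exact: measurable_Frot.
have D0 j x : 0 <= D j x by rewrite lee_fin expR_ge0.
have intD j : \int[G n \x G n]_x D j x <= B%:E.
  pose H (x : rV n * rV n) := (expR (t * (F x.1 - F (rotn (cS th) (fun k => - sS th k)%R x))))%:E.
  have mH : measurable_fun setT H.
    apply/measurable_EFinP; apply: measurableT_comp => //; apply: measurable_funM => //.
    by apply: measurable_funB; [exact: measurableT_comp|exact: measurable_Frot].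
  apply: le_trans (step th t0).
  have H0 x : 0 <= H x by rewrite lee_fin expR_ge0.
  (* Invariance under the rotation by the end angle [j.+1 * th] turns the [j]-th step into the one
     bounded by [step]. *)
  rewrite -(gaussn2_rotation (csS (j.+1%:R * th)) mH H0).
  rewrite le_eqVlt; apply/orP; left; apply/eqP; apply: eq_integral => -[v v'] _.
  by rewrite /D /H /A rotS_sub/= mulrS mulrDl mul1r addrAC subrr add0r.
apply: (@le_trans _ _ (\int[G n \x G n]_x ((m%:R^-1)%:E * \sum_(j < m) D j x))).
  apply: ge0_le_integral => //.
  - apply/measurable_EFinP; apply: measurableT_comp => //; apply: measurable_funM => //.
    by apply: measurable_funB; [exact: measurable_Frot|exact: measurableT_comp].
  - by apply: measurable_funeM; exact: emeasurable_sum.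
  - move=> x _; rewrite sumEFin -EFinM lee_fin.
    apply: le_trans (expR_avg (fun j : 'I_m => t * (F (A j.+1 x) - F (A j x)))%R m0).
    rewrite avgZ /avg -(big_mkord xpredT (fun j => F (A j.+1 x) - F (A j x))%R) telescope_sumr//.
    have am : (m%:R * th = pi / 2)%R by rewrite thE mulrC divfK.
    by rewrite /A am mul0r rot0 tE -(mulrA lam) (mulrA m%:R) divff// mul1r lexx.
rewrite ge0_integralZl//; last 2 first.
- exact: emeasurable_sum.
- by move=> x _; apply: sume_ge0.
rewrite ge0_integral_sum//.
apply: (@le_trans _ _ ((m%:R^-1)%:E * \sum_(j < m) B%:E)).
  by apply: lee_wpmul2l; [rewrite lee_fin invr_ge0|apply: lee_sum => j _].
by rewrite sumEFin -EFinM lee_fin -[leLHS]/(avg _) avg_cst.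
Qed.

Let mean_mix v : mu%:E <= \int[G n]_v' (F (mix (v, v')))%:E.
Proof.
apply: le_trans mean_hinge _.
pose f i x : \bar R := (hinge z (linform (wB i) v + x))%:E.
have mf i (c : R) : measurable_fun setT (fun x : R => f i (c * x)%R).
  apply/measurable_EFinP; apply: (measurableT_comp (measurable_hinge z)).
  by apply: measurable_funD => //; exact: measurable_funM.
have mf1 i : measurable_fun setT (f i).
  apply/measurable_EFinP; apply: (measurableT_comp (measurable_hinge z)).
  exact: measurable_funD.
have f0 i x : 0 <= f i x by rewrite lee_fin hinge_ge0.
have mfl i : measurable_fun setT (fun v' : rV n => f i (linform (wS i) v')).
  by apply: (measurableT_comp (mf1 i)); exact: measurable_linform.
have yB : avg (fun i => linform (wB i) v) = 0%R.
  rewrite /linform /avg exchange_big mulr_sumr; apply: big1 => k _.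
  rewrite -mulr_suml mulrA /wB; case: (boolP (S k)) => Sk.
    by rewrite sumr_const mul0rn mulr0 mul0r.
  by rewrite -[X in (X * _)%R]/(avg (w ^~ k)) avg_big// mul0r.
have -> : \int[G n]_v' (F (mix (v, v')))%:E = \int[N01]_x ((N%:R^-1)%:E * \sum_(i < N) f i (sigma * x)%R).
  transitivity (\int[G n]_v' ((N%:R^-1)%:E * \sum_(i < N) f i (linform (wS i) v'))).
    apply: eq_integral => v' _; rewrite sumEFin -EFinM; congr (_ * _)%:E.
    by apply: eq_bigr => i _; rewrite linf_mix.
  rewrite ge0_integralZl//; last 2 first.
  - exact: emeasurable_sum.
  - by move=> x _; apply: sume_ge0.
  rewrite [RHS]ge0_integralZl//; last 2 first.
  - by apply: emeasurable_sum => i; exact: mf.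
  - by move=> x _; apply: sume_ge0.
  rewrite !ge0_integral_sum//; last by move=> i; exact: mf.
  congr (_ * _); apply: eq_bigr => i _.
  by rewrite gaussn_linform// sqr_wS sqrtr_sqr ger0_norm.
apply: ge0_le_integral => //.
- by move=> x _; rewrite lee_fin hinge_ge0.
- apply/measurable_EFinP; apply: (measurableT_comp (measurable_hinge z)).
  exact: measurable_funM.
- by apply: measurable_funeM; apply: emeasurable_sum => i; exact: mf.
- move=> x _; rewrite sumEFin -EFinM lee_fin.
  by apply: le_trans (hinge_avg _ _ N0); rewrite avgD avg_cst// yB add0r.
Qed.

(* Jensen's inequality via the tangent [e^y >= c (1 + y - lam mu)], arranged so
   that only nonnegative functions are integrated. *)
Let exp_mix (lam : R) v : (0 <= lam)%R ->
  (expR (lam * mu))%:E <= \int[G n]_v' (expR (lam * F (mix (v, v'))))%:E.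
Proof.
move=> lam0; set c := expR (lam * mu).
have c0 : (0 <= c)%R by exact: expR_ge0.
have F0 v' : (0 <= F v')%R.
  by rewrite mulr_ge0 ?invr_ge0// sumr_ge0// => i _; exact: hinge_ge0.
have mFm : measurable_fun setT (fun v' => F (mix (v, v'))).
  exact: (measurableT_comp (measurable_Frot _ _) (pair1_measurable v)).
have mE : measurable_fun setT (fun v' => (expR (lam * F (mix (v, v'))))%:E).
  by apply/measurable_EFinP; apply: measurableT_comp => //; exact: measurable_funM.
rewrite -(@leeD2rE _ (c * lam * mu)%:E)//.
apply: (@le_trans _ _ (\int[G n]_v' (c%:E + (c * lam)%:E * (F (mix (v, v')))%:E))).
  rewrite ge0_integralD//; last 2 first.
  - by move=> x _; rewrite mule_ge0// lee_fin// mulr_ge0.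
  - by apply: measurable_funeM; exact/measurable_EFinP.
  rewrite integral_prob_cst ge0_integralZl//; last 3 first.
  - exact/measurable_EFinP.
  - by move=> x _; rewrite lee_fin.
  - by rewrite lee_fin mulr_ge0.
  rewrite leeD2l// EFinM; apply: lee_wpmul2l; first by rewrite lee_fin mulr_ge0.
  exact: mean_mix.
rewrite -[X in _ <= _ + X](integral_prob_cst (G n)) -ge0_integralD//; last first.
  by move=> x _; rewrite lee_fin !mulr_ge0.
apply: ge0_le_integral => //.
- by move=> x _; rewrite adde_ge0// mule_ge0// lee_fin// mulr_ge0.
- by apply: emeasurable_funD => //; apply: measurable_funeM; exact/measurable_EFinP.
- by apply: emeasurable_funD.
move=> v' _; rewrite -EFinM -!EFinD lee_fin.
have -> : expR (lam * F (mix (v, v'))) = (c * expR (lam * F (mix (v, v')) - lam * mu))%R.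
  by rewrite /c -expRD addrC subrK.
rewrite -!mulrA -[X in (X + _)%R]mulr1 -!mulrDr ler_wpM2l//.
by rewrite -lerBlDr -addrA expR_ge1Dx.
Qed.

(** On the event [K] the functional [F] vanishes at [v], so by [exp_mix] the inner integral in
    [exp_chain] is at least [expR (lam * mu)] there. Dividing by this number bounds the probability
    of [K]. *)
Lemma hinge_concentration (m : nat) (lam t th : R) : (0 < m)%N -> (0 <= lam)%R ->
  t = (lam * m%:R)%R -> th = (pi / 2 / m%:R)%R ->
  G n [set v | forall i, (linform (w i) v <= z)%R] <=
  (2 * expR (t ^+ 2 * (1 - cos th) ^+ 2 * sigma ^+ 2 / 2 + t ^+ 2 * sin th ^+ 2 * kappa / 2
     - lam * mu))%:E.
Proof.
move=> m0 lam0 tE thE; set K := [set v | _].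
have mK : measurable K.
  rewrite (_ : K = \bigcap_(i in [set: 'I_N]) ((fun v => linform (w i) v) @^-1` [set x | (x <= z)%R])).
    apply: fin_bigcap_measurable; [exact: finite_finset|move=> i _].
    rewrite -[X in measurable X]setTI; apply: measurable_linform => //.
    rewrite (_ : [set x | _] = `]-oo, z]%classic)//.
  by apply/seteqP; split => v h i; [move=> _|]; exact: h.
rewrite (expRD _ (- (lam * mu))) expRN mulrA EFinM lee_pdivlMr ?expR_gt0//.
apply: le_trans (exp_chain m0 lam0 tE thE).
pose H (x : rV n * rV n) := (expR (lam * (F (mix x) - F x.1)))%:E.
have mH : measurable_fun setT H.
  apply/measurable_EFinP; apply: measurableT_comp => //; apply: measurable_funM => //.
  by apply: measurable_funB; [exact: measurable_Frot|exact: measurableT_comp].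
have H0 x : 0 <= H x by rewrite lee_fin expR_ge0.
apply: (@le_trans _ _ (\int[G n]_v \int[G n]_v' H (v, v'))); last first.
  by rewrite (fubini_tonelli1 _ mH H0).
rewrite -(setIT K) -integral_indic// muleC -ge0_integralZl//; last first.
  by apply/measurable_EFinP.
apply: ge0_le_integral => //.
- by apply: measurable_funeM; apply/measurable_EFinP.
- exact: (measurable_fun_fubini_tonelli_F _ mH H0).
move=> v _; rewrite indicE; have [vK|vK] := boolP (v \in K); last first.
  by rewrite mule0 integral_ge0.
rewrite mule1; apply: le_trans (exp_mix v lam0) _.
rewrite le_eqVlt; apply/orP; left; apply/eqP; apply: eq_integral => v' _.
rewrite /H /= (_ : F v = 0)%R ?subr0//.
rewrite /F -[RHS](avg_cst 0 N0); congr avg; apply/funext => i.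
by apply: hinge_le0; move: vK; rewrite inE; apply.
Qed.

Local Open Scope ring_scope.

Lemma hinge_concentration_lim (lam : R) : 0 <= lam ->
  (G n [set v | forall i, (linform (w i) v <= z)%R] <=
   (2 * expR (1 + 2 * lam ^+ 2 * kappa - lam * mu))%:E)%E.
Proof.
(* A finite [m] suffices: [1 - cos th <= th ^+ 2 / 2] and [th * m = pi / 2 <= 2] give [lam * m * (1
   - cos th) * sigma <= 2 * lam * sigma / m <= 1]. *)
move=> lam0; pose m := (Num.truncn (2 * lam * sigma)).+1.
apply: le_trans (@hinge_concentration m lam _ _ _ lam0 erefl erefl) _ => //.
rewrite lee_fin ler_wpM2l// ler_expR lerD2r.
set th := _ / _ / m%:R; have mR0 : 0 < m%:R :> R by rewrite ltr0n.
have kappa0 : 0 <= kappa.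
  apply: le_trans (@bessel_small (fun=> 0) _); last by move=> i; rewrite lexx ler01.
  by apply: sumr_ge0 => k _; exact: sqr_ge0.
have /andP[pi0 pi2] := pihalf_02 R.
have th0 : 0 <= th by rewrite divr_ge0// ltW.
have thm : th * m%:R = pi / 2 by rewrite divfK// gt_eqF.
have mlam : 2 * lam * sigma <= m%:R by apply: ltW; exact: truncnS_gt.
have h1 : lam * m%:R * (1 - cos th) * sigma <= 1.
  have := onem_cos_le th0 => h.
  have h2 : lam * m%:R * (1 - cos th) * sigma <= lam * m%:R * (th ^+ 2 / 2) * sigma.
    by rewrite ler_wpM2r// ler_wpM2l// mulr_ge0.
  apply: le_trans h2 _.
  rewrite -(ler_pM2r mR0) mul1r; apply: le_trans mlam.
  have -> : lam * m%:R * (th ^+ 2 / 2) * sigma * m%:R = (th * m%:R) ^+ 2 / 4 * (2 * lam * sigma) by field.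
  rewrite thm ler_piMl ?mulr_ge0//.
  have : (pi / 2) ^+ 2 <= 2 ^+ 2 :> R by rewrite lerXn2r ?nnegrE// ltW.
  lra.
have h10 : 0 <= lam * m%:R * (1 - cos th) * sigma by rewrite !mulr_ge0 ?subr_ge0 ?cos_le1.
apply: lerD.
  have -> : (lam * m%:R) ^+ 2 * (1 - cos th) ^+ 2 * sigma ^+ 2 / 2 =
    (lam * m%:R * (1 - cos th) * sigma) ^+ 2 / 2 by field.
  have : (lam * m%:R * (1 - cos th) * sigma) ^+ 2 <= 1 ^+ 2 by rewrite lerXn2r ?nnegrE.
  rewrite expr1n; lra.
have h3 : (lam * m%:R) ^+ 2 * sin th ^+ 2 <= 4 * lam ^+ 2.
  apply: (@le_trans _ _ ((lam * m%:R) ^+ 2 * th ^+ 2)).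
    by rewrite ler_wpM2l ?sqr_ge0// sqr_sin_le.
  have -> : (lam * m%:R) ^+ 2 * th ^+ 2 = lam ^+ 2 * (th * m%:R) ^+ 2 by ring.
  rewrite mulrC ler_wpM2r ?sqr_ge0// thm.
  have : (pi / 2) ^+ 2 <= 2 ^+ 2 :> R by rewrite lerXn2r ?nnegrE// ltW.
  lra.
have := ler_wpM2r kappa0 h3; lra.
Qed.

End concentration.

(** Only the unit interval [[u + 1, u + 2]] with [u = z / sigma] is kept: there the hinge is at
    least [sigma], and the density is at least its value at the right end. *)
Lemma mean_hinge_ge {R : realType} (z sigma : R) : 0 < sigma -> 0 <= z ->
  ((sigma * (normal_peak 1 * expR (- (z / sigma + 2) ^+ 2 / 2)))%:E <=
   \int[stdnormal R]_x (hinge z (sigma * x))%:E)%E.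
Proof.
move=> s0 z0; set u := z / sigma.
have u0 : 0 <= u by rewrite divr_ge0// ltW.
pose I := `[u + 1, u + 2]%classic.
have mI : measurable I by exact: measurable_itv.
have mh : measurable_fun setT (fun x : R => (hinge z (sigma * x))%:E).
  apply/measurable_EFinP; apply: (measurableT_comp (measurable_hinge z)).
  exact: measurable_funM.
apply: (@le_trans _ _ (\int[stdnormal R]_x ((sigma)%:E * (\1_I x)%:E))%E); last first.
  apply: ge0_le_integral => //.
  - by move=> x _; rewrite mule_ge0// lee_fin ltW.
  - by apply: measurable_funeM; apply/measurable_EFinP.
  move=> x _; rewrite -EFinM lee_fin indicE; have [xI|xI] := boolP (x \in I); last first.
    by rewrite mulr0 hinge_ge0.
  move: xI; rewrite inE /I /= in_itv /= => /andP[xu _]; rewrite mulr1 /hinge le_max; apply/orP; left.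
  have : sigma * (u + 1) <= sigma * x by rewrite ler_pM2l.
  have -> : sigma * (u + 1) = z + sigma by rewrite /u; field; rewrite gt_eqF.
  lra.
rewrite ge0_integralZl//; last 2 first.
- by apply/measurable_EFinP.
- by rewrite lee_fin ltW.
rewrite integral_indic// setIT EFinM; apply: lee_wpmul2l; first by rewrite lee_fin ltW.
rewrite stdnormalE /= /normal_prob.
apply: (@le_trans _ _ (\int[lebesgue_measure]_(x in I) (cst (normal_peak 1 * expR (- (u + 2) ^+ 2 / 2))%:E x))%E).
  rewrite integral_cst//= /I lebesgue_measure_itv/= lte_fin ltrD2l ltr1n.
  rewrite -EFinB (_ : u + 2 - (u + 1) = 1) ?mule1//; ring.
apply: ge0_le_integral => //.
- by move=> x _; rewrite lee_fin mulr_ge0 ?normal_peak_ge0 ?expR_ge0.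
- by apply/measurable_EFinP; apply: measurable_funTS; exact: measurable_normal_pdf.
move=> x; rewrite /I /= in_itv /= => /andP[xu xu2].
rewrite lee_fin normal_pdfE ?oner_eq0// ler_wpM2l ?normal_peak_ge0// /normal_fun ler_expR subr0 expr1n.
have : x ^+ 2 <= (u + 2) ^+ 2 by rewrite lerXn2r ?nnegrE//; lra.
lra.
Qed.

(** * Discrete orthogonality and Bessel's inequality *)

Section bessel.
Context {R : realType}.

Lemma avg_sum N n (P : pred 'I_n) (f : 'I_n -> 'I_N -> R) :
  avg (fun i => \sum_(k < n | P k) f k i) = \sum_(k < n | P k) avg (f k).
Proof. by rewrite /avg exchange_big mulr_sumr. Qed.

(** The family is orthogonal with squared norm 1/2, so the projection of [s] on its span is [2 * p].
    The claim is the nonnegativity of the squared distance from [s] to it. *)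
Lemma bessel_avg N n (P : pred 'I_n) (e : 'I_n -> 'I_N -> R) (s : 'I_N -> R) :
  (forall k l, avg (fun i => e k i * e l i) = (k == l)%:R / 2) ->
  \sum_(k < n | P k) avg (fun i => s i * e k i) ^+ 2 <= avg (fun i => s i ^+ 2) / 2.
Proof.
move=> orth; set c := fun k => avg (fun i => s i * e k i).
pose p i := \sum_(k < n | P k) c k * e k i.
have sp : avg (fun i => s i * p i) = \sum_(k < n | P k) c k ^+ 2.
  rewrite -[LHS]/(avg _) (_ : (fun i => _) = fun i => \sum_(k < n | P k) c k * (s i * e k i)).
    by rewrite avg_sum; apply: eq_bigr => k _; rewrite avgZ expr2.
  by apply/funext => i; rewrite mulr_sumr; apply: eq_bigr => k _; rewrite mulrCA.
have pp : avg (fun i => p i ^+ 2) = (\sum_(k < n | P k) c k ^+ 2) / 2.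
  rewrite (_ : (fun i => _) = fun i => \sum_(k < n | P k) c k * (\sum_(l < n | P l) c l * (e k i * e l i))).
    rewrite avg_sum mulr_suml; apply: eq_bigr => k Pk.
    rewrite avgZ avg_sum (bigD1 k)//= avgZ orth eqxx big1 ?addr0; first by rewrite /= mulr1n; field.
    by move=> l /andP[_ lk]; rewrite avgZ orth eq_sym (negbTE lk) mul0r mulr0.
  apply/funext => i; rewrite expr2 {1}/p mulr_suml; apply: eq_bigr => k _.
  by rewrite -mulrA; congr (_ * _); rewrite mulr_sumr; apply: eq_bigr => l _; rewrite mulrCA.
have : 0 <= avg (fun i => (s i - 2 * p i) ^+ 2).
  by rewrite mulr_ge0 ?invr_ge0// sumr_ge0// => i _; exact: sqr_ge0.
rewrite (_ : (fun i => (s i - 2 * p i) ^+ 2) = fun i => (s i ^+ 2 - 4 * (s i * p i)) + 4 * p i ^+ 2); last first.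
  by apply/funext => i; ring.
rewrite avgD avgB !avgZ sp pp; lra.
Qed.

End bessel.

(** * Trigonometric sums over an equally spaced grid *)

Section discrete_trigonometry.
Context {R : realType}.
Variable N : nat.
Hypothesis N0 : (0 < N)%N.

Definition grid_angle (j : nat) (i : nat) : R := 2 * pi * j%:R * (i%:R / N%:R).

Let NR : N%:R != 0 :> R. Proof. by rewrite pnatr_eq0 -lt0n. Qed.

Lemma cosD2pin (x : R) j : cos (2 * pi * j%:R + x) = cos x.
Proof.
by rewrite -[RHS](periodicn (@cosD2pi R) j); congr cos; rewrite -[_ *+ j]mulr_natr -mulr_natr; ring.
Qed.

Lemma sinD2pin (x : R) j : sin (2 * pi * j%:R + x) = sin x.
Proof.
by rewrite -[RHS](periodicn (@sinD2pi R) j); congr sin; rewrite -[_ *+ j]mulr_natr -mulr_natr; ring.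
Qed.

Section sums.
Variable j : nat.
Hypothesis jN : (0 < j < N)%N.
Let h : R := pi * j%:R / N%:R.

Let sin_h : sin h != 0.
Proof.
case/andP: jN => j0 jN'; rewrite gt_eqF// sin_gt0_pi// /h divr_gt0 ?mulr_gt0 ?pi_gt0 ?ltr0n//=.
by rewrite ltr_pdivrMr ?ltr0n// ltr_pM2l ?pi_gt0// ltr_nat.
Qed.

Let angleE (i : nat) : grid_angle j i = 2 * h * i%:R.
Proof. by rewrite /grid_angle /h; field. Qed.

Let angleN : 2 * h * N%:R = 2 * pi * j%:R.
Proof. by rewrite /h; field. Qed.

(** Multiplication by [2 * sin h], with [h] half the angular step, makes the sum telescope over a
    whole number of periods. The factor is nonzero because [0 < j < N]. *)
Lemma sum_cos_grid : \sum_(i < N) cos (grid_angle j i) = 0.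
Proof.
have s20 : 2 * sin h != 0 by rewrite mulf_neq0// pnatr_eq0.
apply: (mulfI s20); rewrite mulr0 mulr_sumr.
under eq_bigr => i _.
  rewrite angleE (_ : 2 * sin h * cos _ = sin (2 * h * (i.+1)%:R - h) - sin (2 * h * i%:R - h)).
    over.
  have -> : 2 * h * i.+1%:R - h = 2 * h * i%:R + h by rewrite -natr1; ring.
  rewrite sinD sinB; ring.
rewrite -(big_mkord xpredT (fun i => sin (2 * h * i.+1%:R - h) - sin (2 * h * i%:R - h))) telescope_sumr//.
by rewrite angleN sinD2pin mulr0 sub0r subrr.
Qed.

Lemma sum_sin_grid : \sum_(i < N) sin (grid_angle j i) = 0.
Proof.
have s20 : - (2 * sin h) != 0 by rewrite oppr_eq0 mulf_neq0// pnatr_eq0.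
apply: (mulfI s20); rewrite mulr0 mulr_sumr.
under eq_bigr => i _.
  rewrite angleE (_ : - (2 * sin h) * sin _ = cos (2 * h * (i.+1)%:R - h) - cos (2 * h * i%:R - h)).
    over.
  have -> : 2 * h * i.+1%:R - h = 2 * h * i%:R + h by rewrite -natr1; ring.
  rewrite cosD cosB; ring.
rewrite -(big_mkord xpredT (fun i => cos (2 * h * i.+1%:R - h) - cos (2 * h * i%:R - h))) telescope_sumr//.
by rewrite angleN cosD2pin mulr0 sub0r subrr.
Qed.

End sums.

Lemma avg_cos_grid j : (j < N)%N -> avg (fun i : 'I_N => cos (grid_angle j i)) = (j == 0%N)%:R.
Proof.
case: j => [|j] jN; last by rewrite /avg sum_cos_grid ?mulr0.
rewrite (_ : (fun i => _) = fun=> 1) ?avg_cst//; apply/funext => i.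
by rewrite /grid_angle mulr0 mul0r cos0.
Qed.

Lemma avg_sin_grid j : (j < N)%N -> avg (fun i : 'I_N => sin (grid_angle j i)) = 0.
Proof.
case: j => [|j] jN; last by rewrite /avg sum_sin_grid ?mulr0.
rewrite (_ : (fun i => _) = fun=> 0) ?avg_cst//; apply/funext => i.
by rewrite /grid_angle mulr0 mul0r sin0.
Qed.

Let angleD j l i : grid_angle j i + grid_angle l i = grid_angle (j + l) i.
Proof. by rewrite /grid_angle natrD; ring. Qed.

Let angleB j l i : (l <= j)%N -> grid_angle j i - grid_angle l i = grid_angle (j - l) i.
Proof. by move=> lj; rewrite /grid_angle natrB//; ring. Qed.

(** Product-to-sum formula: since [j + l < N], neither the sum nor the difference of the frequencies
    is a nonzero multiple of [N], so only a zero difference survives. The reduction to [l <= j]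
    serves the subtraction on [nat]. *)
Lemma avg_cos_cos j l : (0 < j)%N -> (0 < l)%N -> (j + l < N)%N ->
  avg (fun i : 'I_N => cos (grid_angle j i) * cos (grid_angle l i)) = (j == l)%:R / 2.
Proof.
wlog lj : j l / (l <= j)%N => [H|] j0 l0 jlN.
  case/orP: (leq_total l j) => lj; first exact: H.
  rewrite eq_sym -H//; last by rewrite addnC.
  by congr avg; apply/funext => i; rewrite mulrC.
rewrite (_ : (fun i => _) = fun i : 'I_N => 2^-1 * (cos (grid_angle (j - l) i) + cos (grid_angle (j + l) i))).
  rewrite avgZ avgD !avg_cos_grid//; last lia.
  rewrite subn_eq0 addn_eq0 (gtn_eqF j0)/= addr0 mulrC; congr (_%:R / _); lia.
by apply/funext => i; rewrite -angleD -angleB// cosB cosD; field.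
Qed.

Lemma avg_sin_sin j l : (0 < j)%N -> (0 < l)%N -> (j + l < N)%N ->
  avg (fun i : 'I_N => sin (grid_angle j i) * sin (grid_angle l i)) = (j == l)%:R / 2.
Proof.
wlog lj : j l / (l <= j)%N => [H|] j0 l0 jlN.
  case/orP: (leq_total l j) => lj; first exact: H.
  rewrite eq_sym -H//; last by rewrite addnC.
  by congr avg; apply/funext => i; rewrite mulrC.
rewrite (_ : (fun i => _) = fun i : 'I_N => 2^-1 * (cos (grid_angle (j - l) i) - cos (grid_angle (j + l) i))).
  rewrite avgZ avgB !avg_cos_grid//; last lia.
  rewrite subn_eq0 addn_eq0 (gtn_eqF j0)/= subr0 mulrC; congr (_%:R / _); lia.
by apply/funext => i; rewrite -angleD -angleB// cosB cosD; field.
Qed.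

Lemma avg_sin_cos j l : (j + l < N)%N ->
  avg (fun i : 'I_N => sin (grid_angle j i) * cos (grid_angle l i)) = 0.
Proof.
move=> jlN.
have e (i : 'I_N) : sin (grid_angle j i) * cos (grid_angle l i) =
    2^-1 * (sin (grid_angle (j + l) i) + sin (grid_angle j i - grid_angle l i)).
  by rewrite -angleD sinD sinB; field.
under [in LHS]eq_fun do rewrite e.
rewrite avgZ avgD avg_sin_grid// add0r; case/orP: (leq_total l j) => lj.
  under eq_fun do rewrite angleB//.
  by rewrite avg_sin_grid ?mulr0//; lia.
rewrite (_ : (fun i => _) = fun i : 'I_N => (-1) * sin (grid_angle (l - j) i)).
  by rewrite avgZ avg_sin_grid ?mulr0//; lia.
by apply/funext => i; rewrite -angleB// -opprB sinN mulN1r.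
Qed.

Variables (J : nat -> nat) (n0 : nat).
Hypothesis J0 : forall k, (0 < k)%N -> (0 < J k)%N.
Hypothesis Jincr : forall k l, (0 < k)%N -> (k < l)%N -> (J k < J l)%N.
Hypothesis JN : (2 * J n0 < N)%N.

(** Cosines first, then sines, in the order of the coefficients in [joint_normal_law]. *)
Definition trig_family (k i : nat) : R :=
  if (k < n0)%N then cos (grid_angle (J k.+1) i) else sin (grid_angle (J (k - n0).+1) i).

Let Jle k : (0 < k <= n0)%N -> (J k <= J n0)%N.
Proof.
by case/andP => k0; rewrite leq_eqVlt => /orP[/eqP ->//|kn]; exact/ltnW/Jincr.
Qed.

Let Jeq k l : (0 < k)%N -> (0 < l)%N -> (J k == J l) = (k == l).
Proof.
move=> k0 l0; case: (ltngtP k l) => [kl|lk|->]; last by rewrite eqxx.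
- by rewrite ltn_eqF// Jincr.
- by rewrite gtn_eqF// Jincr.
Qed.

Let Jsum k l : (k < n0)%N -> (l < n0)%N -> (J k.+1 + J l.+1 < N)%N.
Proof.
move=> kn ln; have := @Jle k.+1 kn; have := @Jle l.+1 ln; lia.
Qed.

Lemma trig_family_orthogonal (k l : 'I_(n0 + n0)) :
  avg (fun i : 'I_N => trig_family k i * trig_family l i) = (k == l)%:R / 2.
Proof.
have hk := ltn_ord k; have hl := ltn_ord l.
have ekl : (k == l) = (k == l :> nat) by [].
rewrite /trig_family ekl; case: ltnP => kn; case: ltnP => ln.
- by rewrite avg_cos_cos ?J0 ?Jsum// Jeq.
- have e : (k == l :> nat) = false by lia.
  under eq_fun do rewrite mulrC.
  by rewrite avg_sin_cos ?e ?mul0r// Jsum//; lia.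
- have e : (k == l :> nat) = false by lia.
  by rewrite avg_sin_cos ?e ?mul0r// Jsum//; lia.
- have ek : (k - n0 < n0)%N by lia.
  have el : (l - n0 < n0)%N by lia.
  rewrite avg_sin_sin ?J0 ?Jsum// Jeq//; congr (_%:R / _); lia.
Qed.

Lemma trig_family_mean0 (k : nat) : (k < n0 + n0)%N -> avg (fun i : 'I_N => trig_family k i) = 0.
Proof.
move=> hk; rewrite /trig_family; case: ltnP => kn.
  rewrite avg_cos_grid ?gtn_eqF ?J0//; have := Jsum kn kn; lia.
rewrite avg_sin_grid//.
have ek : (k - n0 < n0)%N by lia.
have := Jsum ek ek; lia.
Qed.

End discrete_trigonometry.

(** * Small values of the supremum *)

Section supremum.
Context {R : realType} {d : measure_display} {T : measurableType d}.
Variables (P : probability T R) (a : nat -> R) (j : nat -> nat) (g g' : nat -> {RV P >-> R}) (x : R).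
Local Notation X t w := (random_trig_poly a j g g' x t w).

Lemma continuous_random_trig_poly w : continuous (fun t => X t w).
Proof.
rewrite /random_trig_poly; elim: (index_iota _ _) => [|k s IH] t.
  by under eq_fun do rewrite big_nil; exact: cvg_cst.
under eq_fun do rewrite big_cons.
apply: cvgD; last exact: IH.
apply: cvgM; first exact: cvg_cst.
have cl : 2 * pi * (j k)%:R * s0 @[s0 --> t] --> 2 * pi * (j k)%:R * t.
  by apply: cvgM; [exact: cvg_cst|exact: cvg_id].
apply: cvgD; apply: cvgM; try exact: cvg_cst.
- by apply: (@continuous_comp _ _ _ (fun s => 2 * pi * (j k)%:R * s) (@cos R)) => //; exact: continuous_cos.
- by apply: (@continuous_comp _ _ _ (fun s => 2 * pi * (j k)%:R * s) (@sin R)) => //; exact: continuous_sin.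
Qed.

Lemma measurable_random_trig_poly t : measurable_fun setT (fun w => X t w).
Proof.
apply: measurable_sum => k; apply: measurable_funM => //.
apply: measurable_funD; apply: measurable_funM => //; exact: measurable_funPT.
Qed.

Lemma random_trig_poly_bounded w : exists M : R, forall t, X t w <= M.
Proof.
exists (\sum_(1 <= k < (Num.truncn x).+1) `|a k| * (`|g k w| + `|g' k w|)) => t.
apply: ler_sum => k _; apply: le_trans (ler_norm _) _; rewrite normrM ler_wpM2l//.
apply: le_trans (ler_normD _ _) _; rewrite !normrM.
by apply: lerD; rewrite ler_piMr// ?cos_max ?sin_max.
Qed.

(** Boundedness matters here, since [sup] takes a default value on sets that are not bounded
    above. *)
Lemma sup_le_trig w z : (sup [set X t w | t in `[0, 1]] <= z) <->
  (forall t, 0 <= t <= 1 -> X t w <= z).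
Proof.
have [M XM] := random_trig_poly_bounded w; split => [h t t01|h].
  apply: le_trans h; apply: ub_le_sup; last by exists t => //; rewrite /= in_itv.
  by exists M => _ [s _ <-].
apply: ge_sup; first by exists (X 0 w), 0 => //; rewrite /= in_itv/= lexx ler01.
by move=> _ [t t01 <-]; apply: h; move: t01; rewrite /= in_itv.
Qed.

(** Paths are continuous, so the supremum is tested on the countable set of points [i / m.+1]. *)
Lemma measurable_sup_le z :
  measurable [set w | sup [set X t w | t in `[0, 1]] <= z].
Proof.
rewrite (_ : [set w | _] = \bigcap_m \bigcap_(i in [set i | (i <= m.+1)%N])
    (fun w => X (i%:R / m.+1%:R) w) @^-1` `]-oo, z]).
  apply: bigcapT_measurable => m; apply: bigcap_measurableType => i _.
  rewrite -[Z in measurable Z]setTI; exact: measurable_random_trig_poly.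
apply/seteqP; split => w /=.
  move=> /sup_le_trig h m _ i /= im; rewrite in_itv/=; apply: h.
  by rewrite divr_ge0//= ler_pdivrMr ?ltr0n// mul1r ler_nat.
move=> h; apply/sup_le_trig => t /andP[t0 t1]; rewrite leNgt; apply/negP => zt.
have : \forall s \near t, z < X s w.
  exact: (cvgr_gt _ (@continuous_random_trig_poly w t) _ zt).
move=> /nbhs_ballP[e /= e0 he].
pose m := Num.truncn e^-1.
have me : m.+1%:R^-1 < e.
  by rewrite invf_plt ?posrE// ?ltr0n//; exact: truncnS_gt.
(* The grid point [i / m.+1] lies at or below [t] and within [e] of it, where the path still exceeds
   [z]. *)
pose i := Num.truncn (t * m.+1%:R).
have tm0 : 0 <= t * m.+1%:R by rewrite mulr_ge0.
have /andP[i1 i2] := truncn_itv tm0.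
have im : (i <= m.+1)%N.
  rewrite -(ler_nat R); apply: le_trans i1 _.
  by rewrite ler_piMl.
have := h m I i im; rewrite /= in_itv/= leNgt => /negP; apply; apply: he.
rewrite /ball /= ger0_norm; last first.
  by rewrite subr_ge0 ler_pdivrMr ?ltr0n.
apply: le_lt_trans me; rewrite -(ler_pM2r (ltr0n _ m.+1)) mulVf ?pnatr_eq0// mulrBl divfK ?pnatr_eq0//.
by rewrite lerBlDl; apply: ltW; rewrite natr1.
Qed.

End supremum.

(** * From the supremum to the grid and the concentration bound *)

Section sup_small.
Context {R : realType} {d : measure_display} {T : measurableType d}.
Variables (P : probability T R) (a : nat -> R) (j : nat -> nat) (g g' : nat -> {RV P >-> R}) (x : R).
Hypothesis j0 : forall k, (1 <= k)%N -> (0 < j k)%N.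
Hypothesis jincr : forall k l, (1 <= k)%N -> (k < l)%N -> (j k < j l)%N.
Hypothesis ig : iid_standard_normal [set k | (1 <= k)%N] g.
Hypothesis ig' : iid_standard_normal [set k | (1 <= k)%N] g'.
Hypothesis indep : independent_families [set k | (1 <= k)%N] g g'.
Let n := Num.truncn x.
Let N := (2 * j n).+1.

Let idx (k : nat) : nat := (if (k < n)%N then k else (k - n)%N).+1.
Let w (i : 'I_N) (k : nat) : R := a (idx k) * trig_family N j n k i.

Let poly_linf (i : 'I_N) (om : T) :
  random_trig_poly a j g g' x (i%:R / N%:R) om =
  linform (w i) (@tuple_of_family _ _ _ P (n + n) (fun k => if (k < n)%N then g k.+1 else g' (k - n).+1) om).
Proof.
rewrite /random_trig_poly /linform big_split_ord /= big_add1 big_mkord -big_split.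
apply: eq_bigr => k _ /=.
rewrite !tnth_mktuple /w /idx /trig_family /= ltn_ord ltnNge leq_addr/= addKn /grid_angle.
by rewrite mulrDr -!mulrA; congr (_ * _ + _ * _); exact: mulrC.
Qed.

Lemma sup_small_prob (tau lam z : R) : 0 < tau -> 0 <= lam -> 0 <= z ->
  let sigma := Num.sqrt (\sum_(1 <= k < n.+1 | a k ^+ 2 <= tau) a k ^+ 2) in
  0 < sigma ->
  (P [set om | (sup [set random_trig_poly a j g g' x t om | t in `[0, 1]] <= z)%R] <=
   (2 * expR (1 + lam ^+ 2 * tau
      - lam * (sigma * (normal_peak 1 * expR (- (z / sigma + 2) ^+ 2 / 2)))))%:E)%E.
Proof.
move=> tau0 lam0 z0 sigma sigma0.
have N0 : (0 < N)%N by [].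
pose S (k : nat) := a (idx k) ^+ 2 <= tau.
pose K : set ((n + n).-tuple (measurableTypeR R)) := [set v | forall i : 'I_N, linform (w i) v <= z].
have mK : measurable K.
  rewrite (_ : K = \bigcap_(i in [set: 'I_N]) ((fun v => linform (w i) v) @^-1` `]-oo, z])).
    apply: fin_bigcap_measurable; [exact: finite_finset|move=> i _].
    by rewrite -[Z in measurable Z]setTI; apply: measurable_linform.
  by apply/seteqP; split => v h i => [_|]; have := h i; rewrite /= in_itv/=; [|exact].
pose V := @tuple_of_family _ _ _ P (n + n) (fun k => if (k < n)%N then g k.+1 else g' (k - n).+1).
apply: (@le_trans _ _ (P (V @^-1` K))).
  apply: le_measure; rewrite ?inE.
  - exact: measurable_sup_le.
  - by rewrite -[Z in measurable Z]setTI; exact: measurable_tuple_of_family.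
  move=> om /= /sup_le_trig h i; rewrite -poly_linf; apply: h.
  by rewrite divr_ge0//= ler_pdivrMr ?ltr0n// mul1r ler_nat ltnW.
rewrite (joint_normal_law ig ig' indep mK).
have JN : (2 * j n < N)%N by [].
have sigma2 : sigma ^+ 2 = \sum_(1 <= k < n.+1 | a k ^+ 2 <= tau) a k ^+ 2.
  by rewrite sqr_sqrtr// sumr_ge0// => k _; exact: sqr_ge0.
(* The Bessel constant is [kappa = tau / 2]: the bound [tau] on the small squared coefficients times
   the squared norm 1/2. *)
have -> : 1 + lam ^+ 2 * tau = 1 + 2 * lam ^+ 2 * (tau / 2) by field.
apply: (@hinge_concentration_lim _ _ _ w S z sigma (tau / 2)) => //.
- exact: ltW.
- move=> k kn _; rewrite /w avgZ; by rewrite trig_family_mean0// mulr0.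
(* Cosine and sine of the same frequency contribute [a k ^+ 2] together, whatever the grid point. *)
- move=> i; rewrite sigma2 big_mkcond big_split_ord /= big_add1 /= [RHS]big_mkcond big_mkord -big_split.
  apply: eq_bigr => k _ /=.
  rewrite /S /w /idx /trig_family /= ltn_ord ltnNge leq_addr/= addKn.
  by case: ifP => _; rewrite ?addr0// !exprMn -mulrDr cos2Dsin2 mulr1.
- move=> s s01.
  apply: (@le_trans _ _ (\sum_(k < n + n | S k) tau * avg (fun i : 'I_N => s i * trig_family N j n k i) ^+ 2)).
    apply: ler_sum => k Sk.
    rewrite (_ : (fun i : 'I_N => s i * w i k) = fun i : 'I_N => a (idx k) * (s i * trig_family N j n k i)).
      by rewrite avgZ exprMn ler_wpM2r// sqr_ge0.
    by apply/funext => i; rewrite /w mulrCA.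
  rewrite -mulr_sumr; apply: ler_wpM2l; first exact: ltW.
  have := bessel_avg (fun k : 'I_(n + n) => S k) s (trig_family_orthogonal N0 j0 jincr JN).
  move=> h; apply: le_trans h _.
  rewrite -[leRHS]mul1r ler_wpM2r// -[leRHS](avg_cst 1 N0); apply: ler_avg => i.
  by have /andP[s0 s1] := s01 i; rewrite expr_le1.
- exact: mean_hinge_ge.
- by rewrite !mulr_ge0 ?normal_peak_ge0 ?expR_ge0// ltW.
Qed.

End sup_small.

(** * Asymptotics *)

(** [1 / tau] is [L] to the power [1 - q / 4], so the surplus factor [expR (q / 4 * l)] of [L] only
    has to exceed [4 * B / eps]. *)
Lemma remainder_small {R : realType} (B q eps l L tau : R) :
  0 < q -> 0 < eps -> 16 * B / (q * eps) <= l ->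
  L = expR l -> tau = expR (- ((1 - q / 4) * l)) -> B / tau <= eps / 4 * L.
Proof.
move=> q0 eps0 l3 LE tauE.
have tau0 : 0 < tau by rewrite tauE expR_gt0.
have e1 : 4 * B / eps <= expR (q / 4 * l).
  apply: le_trans (expR_ge1Dx _).
  have : q / 4 * (16 * B / (q * eps)) <= q / 4 * l by rewrite ler_pM2l// divr_gt0.
  have -> : q / 4 * (16 * B / (q * eps)) = 4 * B / eps by field; rewrite !gt_eqF.
  lra.
have -> : L = expR (q / 4 * l) / tau.
  by rewrite LE tauE -expRN -expRD opprK; congr expR; field.
rewrite mulrA ler_pM2r ?invr_gt0//.
by move: e1; rewrite ler_pdivrMr// => e1; lra.
Qed.

(** With [y = expR (q / 2 * l)], the left exponent is at most [1 - c * y ^+ 3], while the target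
    exponent is at least [- y ^+ 2]. The spare factor [y] absorbs all constants once [l] is
    large. *)
Lemma sup_small_growth {R : realType} (eta B q eps c l sigma L tau z mu : R) :
  0 < eta -> 0 < q -> q = 1 - eta -> 0 <= B -> eps = q / 24 ->
  c = normal_peak 1 ^+ 2 * expR (- (4 + 4 / eps)) / 8 ->
  1 / (8 * eta) <= l -> 6 / (q * c) <= l ->
  L = expR l -> tau = expR (- ((1 - q / 4) * l)) -> z = Num.sqrt (2 * eta * L * l) ->
  mu = sigma * (normal_peak 1 * expR (- (z / sigma + 2) ^+ 2 / 2)) ->
  0 < sigma -> (1 - eps / 2) * L <= sigma ^+ 2 ->
  2 * expR (1 + (mu / (2 * tau)) ^+ 2 * tau - mu / (2 * tau) * mu) <=
  expR (- (L `^ q / Num.sqrt (8 * eta * (B + 1) * l))).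
Proof.
move=> eta0 q0 qE B0 epsE cE l1 l2 LE tauE zE muE s0 hs.
have q1 : q < 1 by rewrite qE; lra.
have eps0 : 0 < eps by rewrite epsE divr_gt0.
have eps1 : eps < 1 by rewrite epsE; lra.
have c0 : 0 < c.
  by rewrite cE divr_gt0// mulr_gt0 ?expR_gt0// exprn_gt0// normal_peak_gt0// oner_eq0.
have L0 : 0 < L by rewrite LE expR_gt0.
have tau0 : 0 < tau by rewrite tauE expR_gt0.
have l0 : 0 < l by apply: lt_le_trans l1; rewrite divr_gt0// mulr_gt0.
have sL : L <= (1 + eps) * sigma ^+ 2.
  have : (1 + eps) * ((1 - eps / 2) * L) <= (1 + eps) * sigma ^+ 2.
    by rewrite ler_pM2l//; lra.
  apply: le_trans; rewrite mulrA ler_peMl ?(ltW L0)//.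
  have : 0 <= eps * (1 - eps) by rewrite mulr_ge0 ?ltW// subr_gt0.
  lra.
have s20 : 0 < sigma ^+ 2 by rewrite exprn_gt0.
have u2 : (z / sigma) ^+ 2 <= 2 * eta * (1 + eps) * l.
  have Ll0 : 0 <= 2 * eta * L * l by rewrite !mulr_ge0// ltW.
  rewrite expr_div_n zE (sqr_sqrtr Ll0) ler_pdivrMr//.
  have := ler_wpM2l (ltW (mulr_gt0 eta0 l0)) sL; lra.
(* Young's inequality with weight [eps]. The choice [eps = q / 24] makes [2 * eta * (1 + eps) ^+ 2]
   at most [2 * eta + 6 * eps = 2 * eta + q / 4]. *)
have u2' : (z / sigma + 2) ^+ 2 <= (2 * eta + q / 4) * l + (4 + 4 / eps).
  have : (z / sigma + 2) ^+ 2 <= (1 + eps) * (z / sigma) ^+ 2 + (4 + 4 / eps).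
    rewrite -subr_ge0.
    have -> : (1 + eps) * (z / sigma) ^+ 2 + (4 + 4 / eps) - (z / sigma + 2) ^+ 2 =
      (eps * (z / sigma) - 2) ^+ 2 / eps by field; rewrite !gt_eqF.
    by rewrite divr_ge0 ?sqr_ge0// ltW.
  have : (1 + eps) * (z / sigma) ^+ 2 <= (1 + eps) * (2 * eta * (1 + eps) * l).
    by rewrite ler_wpM2l//; lra.
  have : (1 + eps) * (2 * eta * (1 + eps)) * l <= (2 * eta + q / 4) * l.
    rewrite ler_pM2r//; have e24 : q = 24 * eps by rewrite epsE; field.
    have eta1 : eta < 1 by lra.
    have : 2 * eta * eps * eps <= 2 * 1 * eps * 1.
      by rewrite ler_pM// ?mulr_ge0// ?ltW// ltr_pM2r// ltr_pM2l.
    have : 4 * eta * eps <= 4 * 1 * eps by rewrite ler_pM2r// ler_pM2l// ltW.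
    rewrite e24; lra.
  lra.
have mu2 : 4 * tau * (c * expR (3 * q / 2 * l)) <= mu ^+ 2.
  rewrite muE !exprMn -expRM_natl.
  have -> : expR (2%:R * (- (z / sigma + 2) ^+ 2 / 2)) = expR (- (z / sigma + 2) ^+ 2) by congr expR; lra.
  have e1 : expR (- ((2 * eta + q / 4) * l)) * expR (- (4 + 4 / eps)) <= expR (- (z / sigma + 2) ^+ 2).
    by rewrite -expRD ler_expR; lra.
  have e2 : L / 2 <= sigma ^+ 2.
    have : (1 + eps) * sigma ^+ 2 <= 2 * sigma ^+ 2 by rewrite ler_pM2r//; lra.
    lra.
  have -> : 4 * tau * (c * expR (3 * q / 2 * l)) =
     (L / 2) * (normal_peak 1 ^+ 2 * (expR (- ((2 * eta + q / 4) * l)) * expR (- (4 + 4 / eps)))).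
    have -> : expR (- ((2 * eta + q / 4) * l)) = tau * expR (3 * q / 2 * l) / L.
      rewrite tauE LE -expRD -expRN -expRD; congr expR; rewrite qE; lra.
    by rewrite cE; field; rewrite gt_eqF.
  apply: ler_pM; [by rewrite divr_ge0// ltW| |exact: e2|].
    by rewrite !mulr_ge0 ?expR_ge0 ?normal_peak_ge0.
  by rewrite ler_wpM2l ?exprn_ge0 ?normal_peak_ge0.
(* [lam = mu / (2 * tau)] minimises [lam ^+ 2 * tau - lam * mu]. *)
have ex : 1 + (mu / (2 * tau)) ^+ 2 * tau - mu / (2 * tau) * mu = 1 - mu ^+ 2 / (4 * tau).
  by field; rewrite gt_eqF.
rewrite ex.
have mu3 : c * expR (3 * q / 2 * l) <= mu ^+ 2 / (4 * tau).
  by rewrite ler_pdivlMr ?mulr_gt0// mulrC.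
have Lq : L `^ q = expR (q / 2 * l) ^+ 2.
  by rewrite LE -expRM -expRM_natl; congr expR; field.
have e3 : expR (3 * q / 2 * l) = expR (q / 2 * l) ^+ 3.
  by rewrite -expRM_natl; congr expR; field.
set y := expR (q / 2 * l) in Lq e3.
have y1 : 1 <= y.
  apply: le_trans (expR_ge1Dx _); rewrite lerDl mulr_ge0 ?ltW// divr_gt0//.
have y2 : 3 <= c * y.
  have : c * (q / 2 * (6 / (q * c))) <= c * (q / 2 * l) by rewrite ler_pM2l// ler_pM2l// divr_gt0.
  have -> : c * (q / 2 * (6 / (q * c))) = 3 by field; rewrite !gt_eqF.
  have : c * (1 + q / 2 * l) <= c * y by rewrite ler_pM2l// expR_ge1Dx.
  lra.
have sq1 : 1 <= Num.sqrt (8 * eta * (B + 1) * l).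
  have h8 : 1 <= 8 * eta * l.
    by move: l1; rewrite ler_pdivrMr ?mulr_gt0// => ?; lra.
  rewrite -[leLHS]sqrtr1 ler_wsqrtr//.
  have : 0 <= 8 * eta * l * B by rewrite mulr_ge0// (le_trans ler01).
  lra.
have Lq1 : L `^ q / Num.sqrt (8 * eta * (B + 1) * l) <= y ^+ 2.
  by rewrite Lq ler_pdivrMr ?(lt_le_trans _ sq1)// ler_peMr// sqr_ge0.
have two : 2 <= expR 1 :> R by apply: le_trans (expR_ge1Dx _); lra.
apply: (@le_trans _ _ (expR 1 * expR (1 - mu ^+ 2 / (4 * tau)))).
  by rewrite ler_wpM2r ?expR_ge0.
rewrite -expRD ler_expR.
have : 3 * y ^+ 2 <= c * y ^+ 3 by rewrite (exprS y 2) mulrA ler_wpM2r ?sqr_ge0.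
have : 1 <= y ^+ 2 by rewrite expr_ge1// (le_trans ler01).
rewrite e3 in mu3; lra.
Qed.

(** If [a k ^+ 2 > tau], then [a k ^+ 2 * tau <= a k ^+ 4], and the fourth powers sum to [B]. *)
Lemma large_terms_le {R : realType} (a : nat -> R) (B tau : R) n : 0 < tau ->
  (\sum_(1 <= k <oo) (a k ^+ 4)%:E = B%:E)%E ->
  \sum_(1 <= k < n.+1 | ~~ (a k ^+ 2 <= tau)) a k ^+ 2 <= B / tau.
Proof.
move=> tau0 sumB.
have a40 k : 0 <= a k ^+ 4 by rewrite (exprM _ 2 2) sqr_ge0.
have h : \sum_(1 <= k < n.+1) a k ^+ 4 <= B.
  rewrite -lee_fin -sumEFin -sumB; apply: nneseries_lim_ge => k _ _.
  by rewrite lee_fin.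
rewrite ler_pdivlMr// mulr_suml; apply: le_trans h.
rewrite big_mkcond; apply: ler_sum => k _; case: ifPn => //.
rewrite -ltNge => /ltW ht; rewrite (exprM _ 2 2) [leRHS]expr2.
by rewrite ler_wpM2l ?sqr_ge0.
Qed.

Theorem corollary1p8 (R : realType) :
  exists2 C : R, 0 < C &
  forall (eta : R) (a : nat -> R) (j : nat -> nat) (B : R)
    (d : measure_display) (T : measurableType d) (P : probability T R)
    (g g' : nat -> {RV P >-> R}),
  0 < eta < 1 ->
  (forall k, (1 <= k)%N -> (0 < j k)%N) ->
  (forall k l, (1 <= k)%N -> (k < l)%N -> (j k < j l)%N) ->
  iid_standard_normal [set k | (1 <= k)%N] g ->
  iid_standard_normal [set k | (1 <= k)%N] g' ->
  independent_families [set k | (1 <= k)%N] g g' ->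
  sum_squares a x / loglog x @[x --> +oo_R] --> (1 : R) ->
  (\sum_(1 <= k <oo) (a k ^+ 4)%:E = B%:E)%E ->
  \forall x \near +oo_R,
    (P [set w | (sup [set random_trig_poly a j g g' x t w | t in `[0, 1]]
                 <= Num.sqrt (2 * eta * loglog x * logloglog x))%R] <=
     (expR (- (C * loglog x `^ (1 - eta)
               / Num.sqrt (8 * eta * (B + 1) * logloglog x))))%:E)%E.
Proof.
(* [C = 1] works, as the gain of a power of [loglog x] in the exponent outweighs any constant. *)
exists 1 => // eta a j B d T P g g' /andP[eta0 eta1] j0 jincr ig ig' indep cvgA sumB.
pose q := 1 - eta; pose eps := q / 24.
pose c : R := normal_peak 1 ^+ 2 * expR (- (4 + 4 / eps)) / 8.
have q0 : 0 < q by rewrite subr_gt0.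
have eps0 : 0 < eps by rewrite divr_gt0.
have c0 : 0 < c.
  by rewrite divr_gt0// mulr_gt0 ?expR_gt0// exprn_gt0// normal_peak_gt0// oner_eq0.
have B0 : 0 <= B.
  rewrite -lee_fin -sumB; apply: nneseries_ge0 => k _ _.
  by rewrite lee_fin (exprM _ 2 2) sqr_ge0.
(* Thresholds for [logloglog x]: [l1] bounds the square root below by 1, [l2] beats the constant
   [c], and [l3] makes the large coefficients negligible. All are nonnegative, so their sum
   dominates each. *)
pose l1 := 1 / (8 * eta); pose l2 := 6 / (q * c); pose l3 := 16 * B / (q * eps).
have l10 : 0 <= l1 by rewrite divr_ge0// mulr_ge0// ltW.
have l20 : 0 <= l2 by rewrite divr_ge0// mulr_ge0// ltW.
have l30 : 0 <= l3 by rewrite divr_ge0// mulr_ge0// ltW.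
have ratio : \forall x \near +oo_R, 1 - eps / 4 < sum_squares a x / loglog x.
  by apply: (cvgr_gt _ cvgA); rewrite ltrBlDr ltrDl divr_gt0.
near=> x.
have hx : expR (expR (expR (l1 + l2 + l3))) <= x by near: x; exact: nbhs_pinfty_ge.
have hlx : expR (expR (l1 + l2 + l3)) <= ln x.
  by rewrite -[leLHS]expRK ler_ln ?posrE ?expR_gt0// (lt_le_trans _ hx)// expR_gt0.
have hL : expR (l1 + l2 + l3) <= loglog x.
  by rewrite -[leLHS]expRK ler_ln ?posrE ?expR_gt0// (lt_le_trans _ hlx)// expR_gt0.
have L0 : 0 < loglog x by apply: lt_le_trans hL; exact: expR_gt0.
have hl : l1 + l2 + l3 <= logloglog x.
  by rewrite -[leLHS]expRK ler_ln ?posrE ?expR_gt0.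
have LE : loglog x = expR (logloglog x) by rewrite lnK// posrE.
have hA : (1 - eps / 4) * loglog x <= sum_squares a x.
  by rewrite -ler_pdivlMr//; apply: ltW; near: x.
set L := loglog x in L0 hL LE hA *; set l := logloglog x in hl LE *.
pose tau := expR (- ((1 - q / 4) * l)).
have tau0 : 0 < tau by exact: expR_gt0.
pose n := Num.truncn x.
pose sigma := Num.sqrt (\sum_(1 <= k < n.+1 | a k ^+ 2 <= tau) a k ^+ 2).
(* One loss of [eps / 4 * L] comes from the asymptotics of [sum_squares], another from the discarded
   large coefficients. *)
have sigma2 : (1 - eps / 2) * L <= sigma ^+ 2.
  rewrite sqr_sqrtr; last by apply: sumr_ge0 => k _; exact: sqr_ge0.
  have hl3 : 16 * B / (q * eps) <= l by rewrite -/l3; lra.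
  have := remainder_small q0 eps0 hl3 LE erefl.
  have := large_terms_le n tau0 sumB.
  move: hA; rewrite /sum_squares (bigID (fun k => a k ^+ 2 <= tau))/=.
  rewrite -/n -/tau; lra.
have sigma0 : 0 < sigma.
  rewrite lt_neqAle sqrtr_ge0 andbT eq_sym; apply/eqP => s0.
  have : 0 < (1 - eps / 2) * L.
    rewrite mulr_gt0// /eps /q; lra.
  by rewrite ltNge; apply/negP/negPn; move: sigma2; rewrite s0 expr0n.
pose z := Num.sqrt (2 * eta * L * l).
pose mu := sigma * (normal_peak 1 * expR (- (z / sigma + 2) ^+ 2 / 2)).
have mu0 : 0 <= mu by rewrite !mulr_ge0 ?normal_peak_ge0 ?expR_ge0// ltW.
have lam0 : 0 <= mu / (2 * tau) by rewrite divr_ge0// mulr_ge0// ltW.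
apply: le_trans (sup_small_prob j0 jincr ig ig' indep tau0 lam0 (sqrtr_ge0 _) sigma0) _.
rewrite lee_fin mul1r.
apply: (@sup_small_growth R eta B q eps c l sigma L tau z mu) => //.
- rewrite -/l1; lra.
- rewrite -/l2; lra.
Unshelve. all: by end_near.
Qed.
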